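(* Let $m\in\mathbb N$, $J=\{1,\dots,m\}$. Let $q_0,q_1\in(0,\infty]$ and $\vec p_i=(p_{ij})_{j\in J},\vec s_i=(s_{ij})_{j\in J},\vec r_i=(r_{ij})_{j\in J}\in(0,\infty]^m$ for $i=0,1$ satisfy, for all $j\in J$, $$\frac1{p_{1j}}-\frac1{p_{0j}}=\frac1{s_{1j}}-\frac1{s_{0j}}=\frac1{r_{0j}}-\frac1{r_{1j}}=:\frac1{\gamma_j},\qquad \frac1{q_1}-\frac1{q_0}=\frac1\gamma:=\sum_{j\in J}\frac1{\gamma_j}.$$ Let $w_{1j},v_{1j}$ ($j\in J$) be weights with $[w_{1j},v_{1j}]_{(s_{1j},r_{1j})}<\infty$, put $w_1:=\prod_jw_{1j}$, and for each $j$ let $(t_{0j},t_{1j},w_{t_{1j}},v_{t_{1j}},W_j)$ be associated to $(\frac1{\gamma_j},s_{0j},r_{0j},w_{1j},v_{1j})$ as in the context. Assume: (i) $\mathcal M$ is bounded from $L^{t_{1j}}_{v_{t_{1j}}}(\Omega)$ to $L^{t_{1j}}_{w_{t_{1j}}}(\Omega)$ for all $j\in J$; (ii) for each $j$ there are a set $V_j$ and a map $S_j:V_j\to L^0(\Omega)$, there is a map $$T:\prod_{j\in J}\ \bigcup_{(w_{0j},v_{0j})\in W_j}S_j^{-1}\big(L^{p_{0j}}_{v_{0j}}(\Omega)\big)\to L^0(\Omega),$$ and a function $\phi:\mathbb R^m\to\mathbb R$ increasing in each component, such that for all $((w_{0j},v_{0j}))_{j\in J}\in W_1\times\dots\times W_m$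 and all $\vec f=(f_j)_j\in\prod_jS_j^{-1}(L^{p_{0j}}_{v_{0j}}(\Omega))$, $$\|T\vec f\|_{L^{q_0}_{w_0}(\Omega)}\le\phi\big(([w_{0j},v_{0j}]_{(s_{0j},r_{0j})})_{j\in J}\big)\prod_{j\in J}\|S_jf_j\|_{L^{p_{0j}}_{v_{0j}}(\Omega)},\qquad w_0:=\prod_jw_{0j}.$$ Then $\prod_jS_j^{-1}(L^{p_{1j}}_{v_{1j}}(\Omega))$ is contained in the domain of $T$, and for every $\kappa\in(1,\infty)$ and every $\vec f\in\prod_jS_j^{-1}(L^{p_{1j}}_{v_{1j}}(\Omega))$, $$\|T\vec f\|_{L^{q_1}_{w_1}(\Omega)}\le\kappa^\beta\,\phi(\vec C_\kappa)\prod_{j\in J}\|S_jf_j\|_{L^{p_{1j}}_{v_{1j}}(\Omega)},$$ where $\beta:=\sum_j t_{1j}/|\gamma_j|$ and $C_{\kappa j}:=\big(\kappa'\|\mathcal M\|_{L^{t_{1j}}_{v_{t_{1j}}}\to L^{t_{1j}}_{w_{t_{1j}}}}\big)^{t_{1j}/|\gamma_j|}[w_{1j},v_{1j}]_{(s_{1j},r_{1j})}^{t_{1j}/t_{0j}}$.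
   Context: $(\Omega,\mu)$ is a $\sigma$-finite measure space with a fixed basis of sets $\mathcal U$: a countable collection of measurable sets $U$ with $0<\mu(U)<\infty$ such that $\bigcup_{U\in\mathcal U}U=\Omega$ and for all $x,y\in\Omega$ there is $U\in\mathcal U$ with $x,y\in U$. A weight is a measurable function $w:\Omega\to(0,\infty)$. $L^0(\Omega)$ denotes the measurable functions. For $p\in(0,\infty]$ and a weight $w$, $L^p_w(\Omega)$ is the space of measurable $f$ with $\|f\|_{L^p_w(\Omega)}:=\|fw\|_{L^p(\Omega)}<\infty$. For $s,r\in(0,\infty]$ and weights $w,v$, $[w,v]_{(s,r)}:=\sup_{U\in\mathcal U}\mu(U)^{-\frac1s-\frac1r}\|w\|_{L^s(U)}\|v^{-1}\|_{L^r(U)}$ (with $\frac1\infty:=0$). The maximal operator is $\mathcal Mf:=\sup_{U\in\mathcal U}\mu(U)^{-1}\|f\|_{L^1(U)}\mathbf 1_U$; $\|\mathcal M\|_{X\to Y}:=\sup\{\|\mathcal Mf\|_Y:\|f\|_X\le1\}$. For $\kappa\in(1,\infty)$, $\kappa'=\kappa/(\kappa-1)$. Weight classes and rescaled exponents: given $\frac1\gamma\in\mathbb R$, $s_0,r_0\in(0,\infty]$ and weights $w,v$, define $s,r\in(0,\infty]$ by $\frac1s-\frac1{s_0}=\frac1{r_0}-\frac1r=\frac1\gamma$ and $\alpha$ by $\frac1\alpha=\frac1{s_0}+\frac1{r_0}$. If $\frac1\gamma>0$: $t_0:=s_0/\alpha$, $t:=s/\alpha$, $(w_t,v_t):=(w^\alpha,v^\alpha)$.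 If $\frac1\gamma=0$: $t_0:=t:=1$ (no $w_t,v_t$). If $\frac1\gamma<0$: $t_0:=r_0/\alpha$, $t:=r/\alpha$, $(w_t,v_t):=(v^{-\alpha},w^{-\alpha})$. Set $W:=\{(w,v)\}$ if $\frac1\gamma=0$, and otherwise $W:=\{(\tilde w,\tilde v)$ pairs of weights $:\tilde w\tilde v^{-1}=wv^{-1},\ [\tilde w,\tilde v]_{(s_0,r_0)}<\infty\}$. Convention: when $\frac1\gamma=0$, the hypothesis ''$\mathcal M$ bounded from $L^t_{v_t}$ to $L^t_{w_t}$'' is regarded as satisfied and any factor of the form $(\cdots\|\mathcal M\|_{L^t_{v_t}\to L^t_{w_t}})^{t/|\gamma|}$ or $\kappa^{t/|\gamma|}$ is interpreted as $1$ (exponent $0$). *)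

(* Defs.v *)
From HB Require Import structures.
From mathcomp Require Import all_boot all_order all_algebra.
From mathcomp Require Import all_classical all_reals all_analysis.

Set Implicit Arguments.
Unset Strict Implicit.
Unset Printing Implicit Defensive.
Import Order.TTheory GRing.Theory Num.Theory.
Local Open Scope classical_set_scope.
Local Open Scope ring_scope.

Section Defs.
Context {d : measure_display} {X : measurableType d} {R : realType}.

Definition recip (p : \bar R) : R :=
  match p with
  | r%:E => r^-1
  | _ => 0
  end.

Definition ext_of_recip (x : R) : \bar R :=
  if x == 0 then +oo%E else (x^-1)%:E.

Definition weight (w : X -> R) : Prop :=
  measurable_fun setT w /\ forall x, 0 < w x.

Variable mu : {measure set X -> \bar R}.

Definition basis_of_sets (UU : set (set X)) : Prop :=
  countable UU /\
  (forall U, UU U -> measurable U /\ (0 < mu U)%E /\ (mu U < +oo)%E) /\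
  \bigcup_(U in UU) U = setT /\
  (forall x y, exists2 U, UU U & U x /\ U y).

Definition lpw (p : \bar R) (w f : X -> R) : \bar R :=
  Lnorm mu p (fun x => (f x * w x)%:E).

Definition inLpw (p : \bar R) (w f : X -> R) : Prop :=
  measurable_fun setT f /\ (lpw p w f < +oo)%E.

Variable UU : set (set X).

Definition wchar (s r : \bar R) (w v : X -> R) : \bar R :=
  ereal_sup [set ((fine (mu U)) `^ (- (recip s + recip r)))%:E
                 * Lnorm mu s (fun x => (w x * \1_U x)%:E)
                 * Lnorm mu r (fun x => ((v x)^-1 * \1_U x)%:E) | U in UU]%E.

Definition maxop (f : X -> R) : X -> \bar R := fun x =>
  ereal_sup [set ((fine (mu U))^-1)%:E * Lnorm mu 1%:E (fun y => (f y * \1_U y)%:E)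
                 * (\1_U x)%:E | U in UU]%E.

Definition maxop_norm (t : \bar R) (v w : X -> R) : \bar R :=
  ereal_sup [set Lnorm mu t (fun x => (maxop f x * (w x)%:E)%E)
            | f in [set f : X -> R | measurable_fun setT f /\ (lpw t v f <= 1)%E]].

(* Rescaled exponents associated to (1/gamma = ig, s0, r0, w, v):
   1/s = 1/s0 + 1/gamma, 1/r = 1/r0 - 1/gamma, 1/alpha = 1/s0 + 1/r0. *)
Definition ialpha (s0 r0 : \bar R) : R := recip s0 + recip r0.

Definition recip_t (ig : R) (s0 r0 : \bar R) : R :=
  if 0 < ig then (recip s0 + ig) / ialpha s0 r0
  else if ig < 0 then (recip r0 - ig) / ialpha s0 r0
  else 1.

Definition recip_t0 (ig : R) (s0 r0 : \bar R) : R :=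
  if 0 < ig then recip s0 / ialpha s0 r0
  else if ig < 0 then recip r0 / ialpha s0 r0
  else 1.

(* w_t (only meaningful when ig <> 0) *)
Definition wt (ig : R) (s0 r0 : \bar R) (w v : X -> R) : X -> R :=
  if 0 < ig then (fun x => w x `^ (ialpha s0 r0)^-1)
  else (fun x => v x `^ (- (ialpha s0 r0)^-1)).

(* v_t (only meaningful when ig <> 0) *)
Definition vt (ig : R) (s0 r0 : \bar R) (w v : X -> R) : X -> R :=
  if 0 < ig then (fun x => v x `^ (ialpha s0 r0)^-1)
  else (fun x => w x `^ (- (ialpha s0 r0)^-1)).

Definition Wset (ig : R) (s0 r0 : \bar R) (w v : X -> R)
  : set ((X -> R) * (X -> R)) :=
  if ig == 0 then [set (w, v)]
  else [set wv | weight wv.1 /\ weight wv.2 /\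
                 (forall x, wv.1 x / wv.2 x = w x / v x) /\
                 (wchar s0 r0 wv.1 wv.2 < +oo)%E].

End Defs.

(* Main.v *)
(* All exponents are handled through their reciprocals, and all new weights are
   of the form w0 = w1 K^(-ig), v0 = v1 K^(-ig) with K > 0 of controlled integral,
   so that w0/v0 = w1/v1 is automatic and a change of exponent costs one
   application of Hoelder's inequality with the factor K^|ig|.

   Given a probability density k, a Rubio de Francia iteration of the self-map
   H |-> w_t M(H/v_t) of L^t, started at H = k^(1/t), yields K = H^t with K >= k,
   integral at most kappa^t, and w_t M(H/v_t) <= c H.  The last inequality bounds
   K from below on each basis set by an average of K^(1/t)/v_t, which is exactly
   what Hoelder's inequality needs to control the constant of (w0, v0).  The case
   ig < 0 follows from ig > 0 by exchanging (w, v, s, r) and (1/v, 1/w, r, s).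

   If ig_j > 0 one takes for k the normalized |S_j f_j v_1j|^(p_1j), so that the
   norm of S_j f_j does not grow when passing from p_1j to p_0j.  If ig_j < 0 one
   takes for k an arbitrary density, the same for all such j; the resulting
   estimates for ||F k^a||, F = T f prod_j w_1j, a = sum of the |ig_j| over
   ig_j < 0, bound the norm of F by duality. *)
Require Import Defs.
From HB Require Import structures.
From mathcomp Require Import all_boot all_order all_algebra.
From mathcomp Require Import all_classical all_reals all_analysis.
From mathcomp Require Import measurable_realfun ess_sup_inf ring lra.
Import Order.TTheory GRing.Theory Num.Theory.
Local Open Scope classical_set_scope.
Local Open Scope ring_scope.

(** * Norms indexed by the reciprocal of the exponent *)

Lemma powRV {R : realType} (x r : R) : 0 <= x -> x^-1 `^ r = (x `^ r)^-1.
Proof. by move=> x0; rewrite -powR_inv1// -powRrM mulN1r powRN. Qed.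

Section RecipNorm.
Context {d : measure_display} {X : measurableType d} {R : realType}.
Variable mu : {measure set X -> \bar R}.
Implicit Types (f g K : X -> R) (x a b r : R) (p : \bar R).

Lemma recip_ge0 p : (0 < p)%E -> 0 <= recip p.
Proof. by case: p => [r| |]//=; rewrite lte_fin => /ltW; rewrite invr_ge0. Qed.

Lemma recipK p : (0 < p)%E -> ext_of_recip (recip p) = p.
Proof.
rewrite /ext_of_recip; case: p => [r| |]//=; last by rewrite eqxx.
by rewrite lte_fin => r0; rewrite invr_eq0 gt_eqF// invrK.
Qed.

(** With reciprocals as indices, relations between exponents become linear and Hoelder's inequality
    adds indices; the index 0 stands for the supremum norm. *)
Definition Nr x f : \bar R := Lnorm mu (ext_of_recip x) (EFin \o f).

Lemma Nr_ge0 x f : (0 <= Nr x f)%E. Proof. exact: Lnorm_ge0. Qed.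

Lemma measurable_powRX f r : measurable_fun setT f ->
  measurable_fun setT (fun y => f y `^ r).
Proof. by move=> mf; exact: (@measurableT_comp _ _ _ _ _ _ (@powR R ^~ r)). Qed.

Lemma measurable_poweRX (D : X -> \bar R) r : measurable_fun setT D ->
  measurable_fun setT (fun y => D y `^ r)%E.
Proof.
move=> mD; apply: (@measurableT_comp _ _ _ _ _ _ (fun z : \bar R => z `^ r)%E) => //.
exact: measurable_poweR.
Qed.

Lemma measurable_absX f r : measurable_fun setT f ->
  measurable_fun setT (fun y => `|f y| `^ r).
Proof. by move=> mf; apply: measurable_powRX; exact: measurableT_comp. Qed.

Lemma NrE x f : 0 < x ->
  Nr x f = ((\int[mu]_y (`|f y| `^ x^-1)%:E) `^ x)%E.
Proof.
move=> x0; rewrite /Nr /ext_of_recip gt_eqF// unlock /= invrK.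
by under eq_integral do rewrite /= .
Qed.

Lemma Nr0E f : (0 < mu setT)%E ->
  Nr 0 f = ess_sup mu (EFin \o (fun y => `|f y|)).
Proof. by move=> mu0; rewrite /Nr /ext_of_recip eqxx unlock mu0. Qed.

Lemma integral_powR_ge0 f r : (0 <= \int[mu]_y (f y `^ r)%:E)%E.
Proof. by apply: integral_ge0 => y _; rewrite lee_fin powR_ge0. Qed.

Lemma lee_poweR (u v : \bar R) x : 0 <= x -> (0 <= u)%E -> (u <= v)%E ->
  (u `^ x <= v `^ x)%E.
Proof.
move=> x0 u0 uv; apply: gt0_ler_poweR => //; rewrite in_itv/= ?leey ?andbT//.
exact: le_trans uv.
Qed.

Lemma le_Nr x f g : 0 <= x -> measurable_fun setT f -> measurable_fun setT g ->
  {ae mu, forall y, `|f y| <= `|g y|} -> (Nr x f <= Nr x g)%E.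
Proof.
rewrite le_eqVlt => /predU1P[<-|x0] mf mg fg.
  (* At exponent oo, [Lnorm] is 0 by definition when the whole space is null, so this case is split
     off. *)
  have [mu0|mu0] := boolP (0 < mu setT)%E; last first.
    by rewrite /Nr /ext_of_recip eqxx unlock (negbTE mu0).
  by rewrite !Nr0E//; apply: le_ess_sup; apply: filterS fg => y.
rewrite !(NrE _ _ x0); apply: (lee_poweR _ _ _ (ltW x0) (integral_powR_ge0 _ _)).
apply: ae_ge0_le_integral => //.
- exact/measurable_EFinP/measurable_absX.
- exact/measurable_EFinP/measurable_absX.
apply: filterS fg => y fgy _; rewrite lee_fin ge0_ler_powR// ?nnegrE//.
by rewrite invr_ge0 ltW.
Qed.

Lemma NrK p f : (0 < p)%E -> Lnorm mu p (fun y => (f y)%:E) = Nr (recip p) f.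
Proof. by move=> p0; rewrite /Nr recipK. Qed.

Lemma le_NrZ x a f : 0 <= x -> 0 <= a -> measurable_fun setT f ->
  (Nr x (fun y => a * f y)%R <= a%:E * Nr x f)%E.
Proof.
move=> + a0 mf; rewrite le_eqVlt => /predU1P[<-|x0].
  have [mu0|mu0] := boolP (0 < mu setT)%E; last first.
    by rewrite /Nr /ext_of_recip eqxx unlock (negbTE mu0) mule0.
  rewrite !Nr0E// -ess_supZl//; apply: le_ess_sup; apply: nearW => y /=.
  by rewrite normrM (ger0_norm a0).
rewrite !NrE//; have xN0 : x != 0 by rewrite gt_eqF.
have -> : (a%:E = ((a `^ x^-1)%:E `^ x))%E.
  by rewrite poweR_EFin -powRrM mulVf// powRr1.
rewrite -poweRM ?lee_fin ?powR_ge0 ?integral_powR_ge0//.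
rewrite -ge0_integralZl_EFin ?powR_ge0//; last exact/measurable_EFinP/measurable_absX.
rewrite le_eqVlt; apply/orP; left; apply/eqP; congr (_ `^ _)%E.
by apply: eq_integral => y _; rewrite normrM (ger0_norm a0) powRM.
Qed.

(* Hoelder's inequality for Lebesgue exponents in the whole range (0, oo];
   the second factor is written K^b with K integrable. *)
Lemma Nr_holder x b f K : 0 <= x -> 0 < b -> (0 < mu setT)%E ->
  measurable_fun setT f -> measurable_fun setT K -> (forall y, 0 <= K y) ->
  (0 < \int[mu]_y (K y)%:E)%E ->
  (Nr (x + b) (fun y => f y * K y `^ b)%R <=
   Nr x f * (\int[mu]_y (K y)%:E) `^ b)%E.
Proof.
move=> x0 b0 muT mf mK K0 iK0.
have xb0 : 0 < x + b by lra.
have b'0 : 0 <= b^-1 by rewrite invr_ge0 ltW.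
rewrite NrE//.
move: x0; rewrite le_eqVlt => /predU1P[x0|x0].
  rewrite -x0 add0r Nr0E//; set E := ess_sup _ _.
  have E0 : (0 <= E)%E by apply: ess_sup_ger => // y; rewrite lee_fin.
  (* If [E] is infinite, the positive integral of [K] keeps the right-hand side from being oo * 0 =
     0. *)
  have [Ey|Ey] := eqVneq E +oo%E.
    by rewrite Ey gt0_mulye ?leey// poweR_gt0.
  have Efin : E \is a fin_num by rewrite ge0_fin_numE// ltey.
  have fE : {ae mu, forall y, `|f y| <= fine E}.
    have := ess_sup_ge mu (EFin \o (fun y => `|f y|)).
    by apply: filterS => y /=; rewrite -/E -{1}(fineK Efin) lee_fin.
  (* With [E] moved inside the power b, it remains to integrate the pointwise bound |f K^b|^(1/b) <=
     E^(1/b) K. *)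
  have -> : (E * (\int[mu]_y (K y)%:E) `^ b =
             ((fine E `^ b^-1)%:E * (\int[mu]_y (K y)%:E)) `^ b)%E.
    rewrite poweRM ?lee_fin ?powR_ge0//; last exact: ltW.
    rewrite poweR_EFin -powRrM mulVf ?gt_eqF// powRr1 ?fine_ge0//.
    by rewrite fineK.
  apply: lee_poweR; [exact: ltW|by apply: integral_ge0 => y _; rewrite lee_fin powR_ge0|].
  rewrite -ge0_integralZl_EFin ?powR_ge0//; last 2 first.
  - by move=> y _; rewrite lee_fin.
  - exact/measurable_EFinP.
  apply: ae_ge0_le_integral => //.
  - apply/measurable_EFinP/measurable_absX.
    by apply: measurable_funM => //; exact: measurable_powRX.
  - by move=> y _; rewrite -EFinM lee_fin mulr_ge0// powR_ge0.
  - by apply: emeasurable_funM => //; exact/measurable_EFinP.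
  apply: filterS fE => y fy _; rewrite -EFinM lee_fin normrM powRM//.
  rewrite [X in _ * X](_ : _ = K y); last first.
    by rewrite ger0_norm ?powR_ge0// -powRrM mulfV ?gt_eqF// powRr1.
  by rewrite ler_wpM2r// ge0_ler_powR// ?nnegrE// (le_trans _ fy).
have u0 : 0 <= (x + b)^-1 by rewrite invr_ge0 ltW.
(* The classical inequality is applied to |f|^(1/(x+b)) and K^(b/(x+b)) with conjugate exponents
   (x+b)/x and (x+b)/b, then raised to the power x + b. *)
pose F y := `|f y| `^ (x + b)^-1.
pose G y := K y `^ (b / (x + b)).
have mF : measurable_fun setT F by apply: measurable_powRX; exact: measurableT_comp.
have mG : measurable_fun setT G by apply/measurable_powRX.
have P0 : 0 < (x + b) / x by rewrite divr_gt0.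
have Q0 : 0 < (x + b) / b by rewrite divr_gt0.
have PQ : ((x + b) / x)^-1 + ((x + b) / b)^-1 = 1.
  by rewrite !invf_div -mulrDl mulfV// gt_eqF.
have := hoelder mu mF mG P0 Q0 PQ.
rewrite NrE// Lnorm1 unlock /= => H.
have iE : (\int[mu]_y (`|f y * K y `^ b| `^ (x + b)^-1)%:E =
           \int[mu]_y `|F y * G y|%:E)%E.
  apply: eq_integral => y _.
  have FG0 : 0 <= F y * G y by rewrite mulr_ge0 ?powR_ge0.
  by rewrite (ger0_norm FG0) normrM powRM// (ger0_norm (powR_ge0 (K y) b)) -powRrM.
rewrite iE; apply: (le_trans (lee_poweR _ _ _ (ltW xb0) _ H)); first exact: integral_ge0.
rewrite poweRM ?poweR_ge0// -!poweRrM !invf_div !divfK ?gt_eqF//.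
have fE : (\int[mu]_y (`|F y| `^ ((x + b) / x))%:E =
           \int[mu]_y (`|f y| `^ x^-1)%:E)%E.
  apply: eq_integral => y _.
  by rewrite ger0_norm ?powR_ge0// -powRrM mulrA mulVf ?gt_eqF// mul1r.
have KE : (\int[mu]_y (`|G y| `^ ((x + b) / b))%:E = \int[mu]_y (K y)%:E)%E.
  apply: eq_integral => y _.
  rewrite /G (ger0_norm (powR_ge0 _ _)) -powRrM mulrA (divfK (lt0r_neq0 xb0)).
  by rewrite (divff (lt0r_neq0 b0)) powRr1.
rewrite le_eqVlt; apply/predU1P; left.
exact: (f_equal2 (fun u z => u `^ x * z `^ b)%E fE KE).
Qed.

Lemma Nr_pow x th f : 0 <= x -> 0 <= th -> (0 < mu setT)%E ->
  measurable_fun setT f -> (forall y, 0 <= f y) ->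
  forall U : set X,
  (Nr (th * x) (fun y => f y `^ th * \1_U y)%R <=
   (Nr x (fun y => f y * \1_U y)%R) `^ th)%E.
Proof.
move=> x0 + muT mf f0 U; rewrite le_eqVlt => /predU1P[<-|th0].
  rewrite mul0r poweRe0 Nr0E//; apply/ess_supP/nearW => y /=.
  by rewrite lee_fin powRr0 mul1r indicE; case: (y \in U); rewrite ?normr1 ?normr0.
have E y : `|f y `^ th * \1_U y| = `|f y * \1_U y| `^ th.
  rewrite !normrM powRM// ger0_norm ?powR_ge0// (ger0_norm (f0 y)); congr (_ * _).
  by rewrite indicE; case: (y \in U); rewrite /= ?normr1 ?normr0 ?powR1 ?powR0 ?gt_eqF.
move: x0; rewrite le_eqVlt => /predU1P[<-|x0].
  rewrite mulr0 !Nr0E//; set e := (ess_sup _ (_ \o (fun y => `|f y * _|))).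
  apply/ess_supP.
  have := ess_sup_ge mu (EFin \o (fun y => `|f y * \1_U y|)).
  apply: filterS => y /= h; rewrite E -poweR_EFin; apply: lee_poweR => //.
  exact: ltW.
have thx0 : 0 < th * x by rewrite mulr_gt0.
have iE : (\int[mu]_y (`|f y `^ th * \1_U y| `^ (th * x)^-1)%:E =
           \int[mu]_y (`|f y * \1_U y| `^ x^-1)%:E)%E.
  apply: eq_integral => y _; rewrite E -powRrM invfM mulrA.
  by rewrite divff ?gt_eqF// mul1r.
by rewrite !NrE// -poweRrM [x * th]mulrC iE.
Qed.

End RecipNorm.

(** * Duality by testing against probability densities *)

Section Duality.
Context {d : measure_display} {X : measurableType d} {R : realType}.
Variable mu : {measure set X -> \bar R}.
Hypothesis Hsf : sigma_finite setT mu.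
Hypothesis muT : (0 < mu setT)%E.

Lemma integral_ereal_sup (D : set X) (g : nat -> X -> \bar R) (C : \bar R) :
  measurable D -> (forall n, measurable_fun setT (g n)) ->
  (forall n y, (0 <= g n y)%E) ->
  (forall y, nondecreasing_seq (g ^~ y)) ->
  (forall n, (\int[mu]_(y in D) g n y <= C)%E) ->
  (\int[mu]_(y in D) ereal_sup (range (g ^~ y)) <= C)%E.
Proof.
move=> mD mg g0 ndg gC.
under eq_integral => y _ do
  rewrite -(cvg_lim _ (ereal_nondecreasing_cvgn (ndg y)))//.
rewrite monotone_convergence//; last by move=> n; exact: measurable_funTS.
apply: lime_le; last exact: nearW.
apply: ereal_nondecreasing_is_cvgn => m n mn; apply: ge0_le_integral => //.
- exact: measurable_funTS.
- exact: measurable_funTS.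
- by move=> y _; exact: ndg.
Qed.

(* Testing a function against the a-th powers of probability densities
   recovers its norm: this replaces duality, and is valid for all exponents. *)
Lemma Nr_dual (x a : R) (F : X -> R) (C : R) : 0 <= x -> 0 < a -> 0 <= C ->
  measurable_fun setT F ->
  (forall k : X -> R, measurable_fun setT k -> (forall y, 0 <= k y) ->
    (\int[mu]_y (k y)%:E)%E = 1%E ->
    (Nr mu (x + a) (fun y => F y * k y `^ a)%R <= C%:E)%E) ->
  (Nr mu x F <= C%:E)%E.
Proof.
move=> x0 a0 C0 mF H.
have /sigma_finiteP[Om [OmT Omnd mOm]] := Hsf.
have xa0 : 0 < x + a by lra.
move: x0; rewrite le_eqVlt => /predU1P[x0|x0].
  rewrite -x0 Nr0E//; apply/ess_supP.
  (* The sets [B n] exhaust the set where |F| > C. If one had positive measure, its normalized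
     indicator k would give a norm of F k^a of at least C + 1/(n+1). *)
  pose B n := Om n `&` [set y | C + n.+1%:R^-1 <= `|F y|].
  have mB n : measurable (B n).
    apply: measurableI; first exact: (mOm n).1.
    rewrite -[X in measurable X]setTI; apply: measurable_fun_le => //.
    exact: measurableT_comp.
  suff B0 n : mu (B n) = 0%E.
    exists (\bigcup_n B n); split; first exact: bigcup_measurable.
      apply/negligibleP; first exact: bigcup_measurable.
      apply: (@negligible_bigcup _ _ _ mu B) => i.
      by exists (B i); split.
    move=> y /=; rewrite lee_fin => /negP; rewrite -ltNge => Fy.
    have [n1 _ On1] : (\bigcup_n Om n) y by rewrite -OmT.
    have [n2 Hn2] : exists n2 : nat, C + n2.+1%:R^-1 <= `|F y|.
      exists (Num.truncn (`|F y| - C)^-1).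
      rewrite -lerBrDl invf_ple ?posrE ?subr_gt0// ltW//.
      by rewrite Num.Theory.truncnS_gt.
    exists (maxn n1 n2) => //; split.
      by move: On1; apply/subsetPset/Omnd/leq_maxl.
    apply: le_trans Hn2; rewrite lerD2l lef_pV2 ?posrE// ler_nat ltnS.
    exact: leq_maxr.
  apply/eqP; rewrite eq_le measure_ge0 andbT leNgt; apply/negP => Bn0.
  have Bfin : mu (B n) \is a fin_num.
    rewrite ge0_fin_numE//; apply: le_lt_trans (mOm n).2; apply: le_measure.
    - by rewrite inE.
    - by rewrite inE; exact: (mOm n).1.
    - exact: subIsetl.
  have b0 : 0 < fine (mu (B n)) by rewrite fine_gt0// Bn0 ltey_eq Bfin.
  pose k y := (fine (mu (B n)))^-1 * \1_(B n) y.
  have mk : measurable_fun setT k by apply: measurable_funM.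
  have k0 y : 0 <= k y by rewrite mulr_ge0// invr_ge0 ltW.
  have k1 : (\int[mu]_y (k y)%:E = 1)%E.
    under eq_integral do rewrite EFinM.
    rewrite ge0_integralZl_EFin ?invr_ge0 ?ltW//; last first.
      exact/measurable_EFinP.
    by rewrite integral_indic// setIT -(fineK Bfin) -EFinM mulVf ?gt_eqF.
  have := H k mk k0 k1; rewrite -x0 add0r NrE// => Hk.
  pose C1 := C + n.+1%:R^-1.
  have C1C : C < C1 by rewrite /C1 ltrDl invr_gt0.
  have : ((C1 `^ a^-1)%:E `^ a <= C%:E)%E.
    apply: le_trans Hk; apply: lee_poweR; [exact: ltW|by rewrite lee_fin powR_ge0|].
    rewrite -[leLHS]mule1 -k1 -ge0_integralZl_EFin ?powR_ge0//; last 2 first.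
    - by move=> y _; rewrite lee_fin.
    - exact/measurable_EFinP.
    apply: ge0_le_integral => //.
    - by move=> y _; rewrite -EFinM lee_fin mulr_ge0 ?powR_ge0.
    - by apply: emeasurable_funM => //; exact/measurable_EFinP.
    - apply/measurable_EFinP/measurable_absX/measurable_funM => //.
      exact: measurable_powRX.
    move=> y _; rewrite -EFinM lee_fin.
    rewrite normrM powRM// (ger0_norm (powR_ge0 _ a)) -powRrM mulfV ?gt_eqF//.
    rewrite powRr1// /k indicE; have [yB|_] := boolP (y \in B n); last first.
      by rewrite !mulr0.
    rewrite /= !mulr1; apply: ler_wpM2r; first by rewrite invr_ge0 ltW.
    rewrite ge0_ler_powR ?nnegrE//.
    - by rewrite invr_ge0 ltW.
    - by rewrite ltW// (le_lt_trans C0).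
    - by move: yB; rewrite inE => -[].
  rewrite poweR_EFin -powRrM mulVf ?gt_eqF// powRr1 ?lee_fin; last first.
    by rewrite ltW// (le_lt_trans C0).
  by rewrite leNgt C1C.
(* Bounded truncations on sets of finite measure have a finite integral, so they can be normalized
   even if F itself has infinite norm. *)
pose G n y : R := Num.min `|F y| n%:R * \1_(Om n) y.
have mG n : measurable_fun setT (G n).
  apply: measurable_funM => //; last by apply: measurable_indic; exact: (mOm n).1.
  by apply: measurable_minr => //; exact: measurableT_comp.
have G0 n y : 0 <= G n y by rewrite mulr_ge0// le_min normr_ge0 ler0n.
have GF n y : G n y <= `|F y|.
  rewrite /G indicE; case: (y \in Om n); rewrite ?mulr1 ?mulr0//.
  by rewrite ge_min lexx.
have ndG y : nondecreasing_seq (G ^~ y).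
  move=> m n mn; rewrite /G; apply: ler_pM => //.
  - by rewrite le_min !ge_min lexx/= ler_nat mn orbT.
  - rewrite !indicE; have [yO|//] := boolP (y \in Om m).
    suff -> : y \in Om n by [].
    by move: yO; rewrite !inE; apply/subsetPset/Omnd.
have x'0 : 0 <= x^-1 by rewrite invr_ge0 ltW.
have key n : (\int[mu]_y (G n y `^ x^-1)%:E <= (C `^ x^-1)%:E)%E.
  set I := (\int[mu]_y _)%E.
  have I0 : (0 <= I)%E by apply: integral_ge0 => y _; rewrite lee_fin powR_ge0.
  have mGx : measurable_fun setT (fun y => G n y `^ x^-1) by exact: measurable_powRX.
  have Ify : (I < +oo)%E.
    apply: (@le_lt_trans _ _ (\int[mu]_y ((n%:R `^ x^-1)%:E * (\1_(Om n) y)%:E))%E).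
      apply: ge0_le_integral => //.
      - by move=> y _; rewrite lee_fin powR_ge0.
      - exact/measurable_EFinP.
      - by apply: emeasurable_funM => //; apply/measurable_EFinP/measurable_indic; exact: (mOm n).1.
      move=> y _; rewrite -EFinM lee_fin /G indicE; case: (y \in Om n).
        rewrite !mulr1 ge0_ler_powR ?nnegrE ?ge_min ?lexx ?orbT//.
      by rewrite !mulr0 powR0// invr_eq0 gt_eqF.
    rewrite ge0_integralZl_EFin ?powR_ge0//; last first.
      by apply/measurable_EFinP/measurable_indic; exact: (mOm n).1.
    rewrite integral_indic ?setIT//; last exact: (mOm n).1.
    rewrite lte_mul_pinfty ?lee_fin ?powR_ge0//; exact: (mOm n).2.
  have Ifin : I \is a fin_num by rewrite ge0_fin_numE.
  have [I00|In0] := eqVneq I 0%E; first by rewrite I00 lee_fin powR_ge0.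
  have i0 : 0 < fine I by rewrite fine_gt0// lt0e In0 I0 Ify.
  (* This is the extremal density: (G k^a)^(1/(x+a)) = I^(-a/(x+a)) G^(1/x), so the hypothesis gives
     I^x <= C. *)
  pose k y := (fine I)^-1 * G n y `^ x^-1.
  have mk : measurable_fun setT k by apply: measurable_funM.
  have k0 y : 0 <= k y by rewrite mulr_ge0 ?invr_ge0 ?powR_ge0// ltW.
  have k1 : (\int[mu]_y (k y)%:E = 1)%E.
    under eq_integral do rewrite EFinM.
    rewrite ge0_integralZl_EFin ?invr_ge0 ?ltW//; last 2 first.
    - by move=> y _; rewrite lee_fin powR_ge0.
    - exact/measurable_EFinP.
    by rewrite -/I -(fineK Ifin) -EFinM mulVf ?gt_eqF.
  have := H k mk k0 k1; rewrite NrE// => Hk.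
  have : (((fine I `^ (- (a / (x + a))))%:E * I) `^ (x + a) <= C%:E)%E.
    apply: le_trans Hk; apply: lee_poweR; [exact: ltW|by rewrite mule_ge0 ?lee_fin ?powR_ge0|].
    rewrite /I -ge0_integralZl_EFin ?powR_ge0//; last 2 first.
    - by move=> y _; rewrite lee_fin powR_ge0.
    - exact/measurable_EFinP.
    apply: ge0_le_integral => //.
    - by move=> y _; rewrite -EFinM lee_fin mulr_ge0 ?powR_ge0.
    - by apply: emeasurable_funM => //; exact/measurable_EFinP.
    - apply/measurable_EFinP/measurable_absX/measurable_funM => //.
      exact: measurable_powRX.
    move=> y _; rewrite -EFinM lee_fin.
    rewrite normrM (ger0_norm (powR_ge0 _ a)).
    apply: (@le_trans _ _ ((G n y * k y `^ a) `^ (x + a)^-1)); last first.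
      rewrite ge0_ler_powR ?nnegrE ?mulr_ge0 ?powR_ge0//.
      - by rewrite invr_ge0 ltW.
      - by rewrite ler_wpM2r ?powR_ge0.
    rewrite -/I le_eqVlt; apply/orP; left; apply/eqP.
    have [->|Gn] := eqVneq (G n y) 0.
      by rewrite mul0r !powR0 ?mulr0// invr_neq0// gt_eqF.
    have kE : k y = fine I `^ (-1) * G n y `^ x^-1 by rewrite /k powR_inv1 ?ltW.
    rewrite kE; move: {kE} (G n y) Gn (G0 n y) => g Gn g0.
    rewrite (powRM a (powR_ge0 _ _) (powR_ge0 _ _)) mulrCA.
    rewrite powRM ?mulr_ge0 ?powR_ge0// -!powRrM.
    have -> : g * g `^ (x^-1 * a) = g `^ (1 + x^-1 * a).
      by rewrite powRD ?Gn ?implybT// powRr1.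
    rewrite -powRrM; congr (_ `^ _ * _ `^ _); field; first by rewrite gt_eqF.
    by rewrite !gt_eqF.
  have -> : ((fine I `^ (- (a / (x + a))))%:E * I =
             (fine I `^ (- (a / (x + a)) + 1))%:E)%E.
    rewrite powRD ?(gt_eqF i0) ?implybT// powRr1 ?fine_ge0// EFinM.
    by rewrite (fineK Ifin).
  rewrite poweR_EFin -powRrM.
  rewrite (_ : (- (a / (x + a)) + 1) * (x + a) = x); last by field; rewrite gt_eqF.
  rewrite !lee_fin => IC; rewrite -(fineK Ifin) lee_fin.
  have -> : fine I = (fine I `^ x) `^ x^-1.
    by rewrite -powRrM mulfV ?gt_eqF// powRr1 ?fine_ge0.
  by rewrite ge0_ler_powR ?nnegrE ?powR_ge0.
rewrite NrE//.
have -> : C%:E = ((C `^ x^-1)%:E `^ x)%E.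
  by rewrite poweR_EFin -powRrM mulVf ?gt_eqF// powRr1.
apply: lee_poweR; [exact: ltW|exact: integral_powR_ge0|].
have := @integral_ereal_sup setT (fun n y => (G n y `^ x^-1)%:E) _ measurableT.
move=> /(_ (C `^ x^-1)%:E) /= Hsup.
apply: le_trans (Hsup _ _ _ key); first last.
- by move=> y m n mn; rewrite lee_fin ge0_ler_powR ?nnegrE ?ndG.
- by move=> n y; rewrite lee_fin powR_ge0.
- by move=> n; exact/measurable_EFinP/measurable_powRX.
rewrite le_eqVlt; apply/orP; left; apply/eqP.
apply: eq_integral => y _; apply/eqP; rewrite eq_le; apply/andP; split; last first.
  apply: ge_ereal_sup => _ [n _ <-]; rewrite lee_fin ge0_ler_powR ?nnegrE//.
apply: ereal_sup_ubound.
have [n1 _ On1] : (\bigcup_n Om n) y by rewrite -OmT.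
pose n2 := Num.truncn `|F y|.
(* At this index y lies in the exhausting set and the truncation level is above |F y|. *)
exists (maxn n1 n2.+1) => //; congr (_ `^ _)%:E.
rewrite /G indicE mem_set ?mulr1; last by move: On1; apply/subsetPset/Omnd/leq_maxl.
apply/min_idPl; apply: le_trans (ltW (Num.Theory.truncnS_gt _)) _.
by rewrite ler_nat leq_maxr.
Qed.
End Duality.

Set Implicit Arguments.
Unset Strict Implicit.

(** * Maximal operator and Rubio de Francia iteration *)

Section Weight.
Context {d : measure_display} {X : measurableType d} {R : realType}.
Implicit Types v w : X -> R.

Lemma weight_powR v r : weight v -> weight (fun y => v y `^ r).
Proof. by move=> [mv v0]; split=> [|y]; [exact: measurable_powRX|exact: powR_gt0]. Qed.

Lemma weightV v : weight v -> weight (fun y => (v y)^-1).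
Proof.
move=> wv; have [_ v0] := wv.
rewrite (_ : (fun y => _) = (fun y => v y `^ (-1))); first exact: weight_powR.
by apply/funext => y; rewrite powR_inv1 ?ltW.
Qed.

Lemma weightM v w : weight v -> weight w -> weight (fun y => v y * w y).
Proof.
by move=> [mv v0] [mw w0]; split=> [|y]; [exact: measurable_funM|exact: mulr_gt0].
Qed.

End Weight.

Lemma measurable_ereal_sup {d : measure_display} {X : measurableType d}
    {R : realType} (g : nat -> X -> \bar R) :
  (forall n, measurable_fun setT (g n)) ->
  measurable_fun setT (fun x => ereal_sup (range (g ^~ x))).
Proof.
move=> mg; rewrite (_ : (fun x => _) = (fun x => esups (g ^~ x) 0)).
  exact: measurable_fun_esups.
apply/funext => x; rewrite /esups /= /sdrop; congr ereal_sup.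
by apply/seteqP; split=> _ [n _ <-]; exists n.
Qed.

(** * The maximal operator on extended nonnegative functions *)

Section EMaxop.
Context {d : measure_display} {X : measurableType d} {R : realType}.
Variable mu : {measure set X -> \bar R}.
Variable UU : set (set X).
Hypothesis HUU : basis_of_sets mu UU.

Lemma basis_measurable U : UU U -> measurable U.
Proof. by case: HUU => _ [H _] /H[]. Qed.

Lemma basis_fin U : UU U -> 0 < fine (mu U).
Proof. by case: HUU => _ [H _] /H[_ [U0 Uy]]; rewrite fine_gt0// U0 Uy. Qed.

Lemma basis_muE U : UU U -> mu U = (fine (mu U))%:E.
Proof.
by case: HUU => _ [H _] /H[_ [U0 Uy]]; rewrite fineK// ge0_fin_numE.
Qed.

Lemma basis_setT_gt0 : (0 < mu setT)%E.
Proof.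
case: HUU => _ [H [_ /(_ point point)[U UU0 _]]].
have [mU [U0 _]] := H U UU0; apply: lt_le_trans U0 _.
by apply: le_measure; rewrite ?inE.
Qed.

Lemma basis_enum : exists e : nat -> set X, UU = range e.
Proof.
case: HUU => cUU [_ [_ /(_ point point)[U UU0 _]]].
have UU1 : UU != set0 by apply/set0P; exists U.
have /pfcard_geP[/eqP|[f]] := cUU; first by rewrite (negbTE UU1).
by exists f; apply/esym; rewrite image_eq.
Qed.

Lemma wchar_ge0 (s r : \bar R) (w v : X -> R) : (0 <= wchar mu UU s r w v)%E.
Proof.
have [e eE] := basis_enum; have UUe : UU (e 0%N) by rewrite eE; exists 0%N.
apply: le_trans (ereal_sup_ubound _); last by exists (e 0%N).
by rewrite !mule_ge0 ?Lnorm_ge0// lee_fin powR_ge0.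
Qed.

(* The maximal operator on nonnegative extended functions; it ignores null
   sets, so suprema of iterates may take the value +oo. *)
Definition emaxop (D : X -> \bar R) : X -> \bar R := fun x =>
  ereal_sup [set ((fine (mu U))^-1)%:E * (\int[mu]_(y in U) D y)
                 * (\1_U x)%:E | U in UU]%E.

Lemma maxopE (f : X -> R) x : (forall y, 0 <= f y) ->
  maxop mu UU f x = emaxop (EFin \o f) x.
Proof.
move=> f0; congr ereal_sup; apply: eq_imagel => U UU1.
rewrite Lnorm1 [in RHS]integral_mkcond; congr (_ * _ * _)%E.
apply: eq_integral => y _; rewrite patchE /= indicE.
by case: (y \in U); rewrite ?mulr1 ?mulr0 /= ger0_norm.
Qed.

Lemma emaxop_ge (D : X -> \bar R) U x : UU U -> U x ->
  (((fine (mu U))^-1)%:E * \int[mu]_(y in U) D y <= emaxop D x)%E.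
Proof.
move=> UU1 Ux; apply: ereal_sup_ubound; exists U => //.
by rewrite indicE mem_set// mule1.
Qed.

Lemma emaxop_ge0 (D : X -> \bar R) x : (forall y, 0 <= D y)%E ->
  (0 <= emaxop D x)%E.
Proof.
move=> D0; case: HUU => _ [_ [_ /(_ x x)[U UU1 [Ux _]]]].
apply: le_trans (emaxop_ge D UU1 Ux); rewrite mule_ge0 ?integral_ge0//.
Qed.

(** Comparing averages set by set gives at once monotonicity (a = 1), homogeneity, and insensitivity
    to changes on null sets. *)
Lemma le_emaxop (D D' : X -> \bar R) (a : R) x : 0 <= a ->
  (forall y, 0 <= D' y)%E ->
  (forall U, UU U ->
     \int[mu]_(y in U) D y <= a%:E * \int[mu]_(y in U) D' y)%E ->
  (emaxop D x <= a%:E * emaxop D' x)%E.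
Proof.
move=> a0 D'0 DD'; apply: ge_ereal_sup => _ [U UU1 <-].
have [Ux|Ux] := pselect (U x); last first.
  by rewrite indicE memNset// mule0 mule_ge0 ?lee_fin ?emaxop_ge0.
rewrite indicE mem_set// mule1.
apply: le_trans (lee_wpmul2l _ (emaxop_ge D' UU1 Ux)); last by rewrite lee_fin.
by rewrite muleCA lee_wpmul2l ?DD'// lee_fin invr_ge0 ltW ?basis_fin.
Qed.

Lemma measurable_emaxop (D : X -> \bar R) : measurable_fun setT (emaxop D).
Proof.
have [e eE] := basis_enum.
pose g n x := (((fine (mu (e n)))^-1)%:E * (\int[mu]_(y in e n) D y)
                 * (\1_(e n) x)%:E)%E.
have -> : emaxop D = (fun x => ereal_sup (range (g ^~ x))).
  apply/funext => x; congr ereal_sup; rewrite eE.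
  apply/seteqP; split=> [_ [_ [n _ <-] <-]|_ [n _ <-]]; first by exists n.
  by exists (e n) => //; exists n.
apply: measurable_ereal_sup => n; apply: emeasurable_funM => //.
apply/measurable_EFinP/measurable_indic/basis_measurable.
by rewrite eE; exists n.
Qed.

(* Any two points lie in a common basis set, so the averages seen from a
   single point already cover the whole space. *)
Lemma emaxop_gt0 (D : X -> \bar R) x : measurable_fun setT D ->
  (forall y, 0 <= D y)%E -> (0 < \int[mu]_y D y)%E -> (0 < emaxop D x)%E.
Proof.
move=> mD D0 iD; rewrite lt0e emaxop_ge0// andbT.
apply/eqP => A0; move: iD; rewrite lt0e => /andP[/eqP + _]; apply.
have [e eE] := basis_enum.
have me n : measurable (e n) by apply: basis_measurable; rewrite eE; exists n.
have DU n : e n x -> (\int[mu]_(y in e n) D y = 0)%E.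
  move=> ex; have UUe : UU (e n) by rewrite eE; exists n.
  have := emaxop_ge D UUe ex; rewrite A0 => H.
  have : (((fine (mu (e n)))^-1)%:E * \int[mu]_(y in e n) D y == 0)%E.
    rewrite eq_le H mule_ge0 ?integral_ge0//. 
  by rewrite mule_eq0 eqe invr_eq0 gt_eqF ?basis_fin//= => /eqP.
suff : ae_eq mu setT D (cst 0%E).
  move/(ae_eq_integral_abs mu measurableT mD).2.
  by under eq_integral do rewrite gee0_abs//.
have DN n : e n x -> ae_eq mu (e n) D (cst 0%E).
  move=> ex; apply/(ae_eq_integral_abs mu (me n) (measurable_funTS mD)).1.
  by under eq_integral do rewrite gee0_abs//; exact: DU.
have : {ae mu, forall y, forall n, e n x -> e n y -> D y = 0%E}.
  apply/ae_foralln => n; have [ex|ex] := pselect (e n x).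
    by have := DN n ex; apply: filterS => y /=.
  by apply: nearW => y.
apply: filterS => y Hy _ /=; case: HUU => _ [_ [_ /(_ x y)[U + [Ux Uy]]]].
by rewrite eE => -[n _ eU]; apply: (Hy n); rewrite eU.
Qed.

End EMaxop.

(** * Rubio de Francia iteration in weighted L^t *)

Section RubioDeFrancia.
Context {d : measure_display} {X : measurableType d} {R : realType}.
Variable mu : {measure set X -> \bar R}.
Variable UU : set (set X).
Hypothesis HUU : basis_of_sets mu UU.
Local Notation emaxop := (emaxop mu UU).

Lemma ereal_sup_poweR (u : nat -> \bar R) (r : R) : 0 < r ->
  (forall n, (0 <= u n)%E) ->
  ereal_sup (range (fun n => (u n `^ r)%E)) = (ereal_sup (range u) `^ r)%E.
Proof.
move=> r0 u0.
have su n : (u n <= ereal_sup (range u))%E by apply: ereal_sup_ubound; exists n.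
have sur n : (u n `^ r <= ereal_sup (range (fun n => (u n `^ r)%E)))%E.
  by apply: ereal_sup_ubound; exists n.
apply/eqP; rewrite eq_le; apply/andP; split.
  by apply: ge_ereal_sup => _ [n _ <-]; apply: lee_poweR => //; exact: ltW.
have s0 := le_trans (u0 0%N) (su 0%N).
have sr0 := le_trans (poweR_ge0 _ _) (sur 0%N).
rewrite -[leRHS]poweRe1// -(@mulVf _ r) ?gt_eqF// poweRrM.
apply: lee_poweR => //; first exact: ltW.
apply: ge_ereal_sup => _ [n _ <-].
rewrite -[leLHS]poweRe1// -(@mulfV _ r) ?gt_eqF// poweRrM.
by apply: lee_poweR => //; rewrite ?poweR_ge0// invr_ge0 ltW.
Qed.

Lemma ae_fin_poweR (H : X -> \bar R) (t : R) : 0 < t ->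
  measurable_fun setT H -> (forall y, 0 <= H y)%E ->
  (\int[mu]_y (H y `^ t) < +oo)%E -> {ae mu, forall y, H y \is a fin_num}.
Proof.
move=> t0 mH H0 iH.
have mHt : measurable_fun setT (fun y => H y `^ t)%E.
  exact: measurable_poweRX.
have /(integrable_ae measurableT) : mu.-integrable setT (fun y => H y `^ t)%E.
  apply/integrableP; split=> //.
  by under eq_integral do rewrite gee0_abs ?poweR_ge0//.
apply: filterS => y /(_ I); rewrite !ge0_fin_numE ?poweR_ge0// => ?.
by apply: (@lty_poweRy _ _ t) => //; rewrite gt_eqF.
Qed.

(** The operator norm tests real functions, while the iteration below produces extended ones. Since
    H^t is integrable, H is finite almost everywhere and averages do not see the exceptional set;
    [fine \o H], divided by v and normalized, is an admissible test function. *)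
Lemma emaxop_bound (t : R) (v w : X -> R) (H : X -> \bar R) : 0 < t ->
  weight v -> weight w ->
  measurable_fun setT H -> (forall y, 0 <= H y)%E ->
  (0 < \int[mu]_y (H y `^ t) < +oo)%E ->
  (\int[mu]_x (((w x)%:E * emaxop (fun y => H y * (v y)^-1%:E) x) `^ t) <=
   maxop_norm mu UU t%:E v w `^ t * \int[mu]_y (H y `^ t))%E.
Proof.
move=> t0 wv [mw w0] mH H0 /andP[I0 Iy]; have [mv v0] := wv.
have Hfin := ae_fin_poweR t0 mH H0 Iy.
have mHt : measurable_fun setT (fun y => H y `^ t)%E.
  exact: measurable_poweRX.
set I := (\int[mu]_y _)%E in I0 Iy *.
have Ifin : I \is a fin_num by rewrite ge0_fin_numE// ltW.
set i := fine I.
have i0 : 0 < i by rewrite fine_gt0// I0.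
have t'0 : t != 0 by rewrite gt_eqF.
have mfH : measurable_fun setT (fine \o H) by exact: measurableT_comp.
have [mv' _] := weightV wv.
have we0 y : (0 <= (w y)%:E)%E by rewrite lee_fin ltW.
have v'0 y : 0 <= (v y)^-1 by rewrite invr_ge0 ltW.
have fH0 y : 0 <= fine (H y) by exact: fine_ge0.
pose f y := i `^ (- t^-1) * (fine (H y) * (v y)^-1).
have mf : measurable_fun setT f.
  by apply: measurable_funM => //; apply: measurable_funM.
have f0 y : 0 <= f y.
  exact: mulr_ge0 (powR_ge0 _ _) (mulr_ge0 (fH0 y) (v'0 y)).
have fnorm : lpw mu t%:E v f = 1%E.
  rewrite /lpw unlock.
  have -> : (\int[mu]_x `|(f x * v x)%:E| `^ t =
             \int[mu]_x ((i^-1)%:E * H x `^ t))%E.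
    apply: ge0_ae_eq_integral => //.
    - apply: measurable_poweRX.
      by apply: measurableT_comp => //; apply/measurable_EFinP/measurable_funM.
    - by apply: emeasurable_funM.
    - by move=> y _; exact: poweR_ge0.
    - by move=> y _; rewrite mule_ge0 ?poweR_ge0// lee_fin invr_ge0 ltW.
    apply: filterS Hfin => y Hy _.
    rewrite -{1}(fineK Hy) /f -!mulrA mulVf ?gt_eqF// mulr1.
    rewrite abse_EFin ger0_norm ?mulr_ge0 ?powR_ge0 ?fine_ge0//.
    rewrite !poweR_EFin -EFinM powRM ?powR_ge0 ?fine_ge0// -powRrM mulNr mulVf//.
    by rewrite powR_inv1 ?ltW.
  rewrite ge0_integralZl_EFin ?invr_ge0 ?ltW//; last first.
    by move=> y _; exact: poweR_ge0.
  by rewrite -/I -(fineK Ifin) -EFinM mulVf ?gt_eqF// poweR1r.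
have fN : (Lnorm mu t%:E (fun x => (maxop mu UU f x * (w x)%:E)%E) <=
           maxop_norm mu UU t%:E v w)%E.
  by apply: ereal_sup_ubound; exists f => //; split; rewrite // fnorm.
have mE : measurable_fun setT (emaxop (EFin \o f)) by exact: measurable_emaxop.
have fNt : (\int[mu]_x ((emaxop (EFin \o f) x * (w x)%:E) `^ t) <=
    maxop_norm mu UU t%:E v w `^ t)%E.
  apply: le_trans (lee_poweR _ _ _ (ltW t0) (Lnorm_ge0 _ _ _) fN).
  rewrite poweR_Lnorm// le_eqVlt; apply/orP; left; apply/eqP.
  apply: eq_integral => x _; rewrite maxopE// gee0_abs// mule_ge0//.
  by apply: emaxop_ge0 => // y; rewrite lee_fin.
have iH : (0 <= i `^ t^-1) by exact: powR_ge0.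
apply: (@le_trans _ _ (\int[mu]_x (i%:E * (emaxop (EFin \o f) x * (w x)%:E) `^ t))%E);
    last first.
  rewrite ge0_integralZl_EFin ?(ltW i0)//; last 2 first.
  - by move=> x _; exact: poweR_ge0.
  - apply: measurable_poweRX.
    by apply: emeasurable_funM => //; exact/measurable_EFinP.
  by rewrite muleC -/I -(fineK Ifin) lee_wpmul2r// lee_fin (ltW i0).
have mHv : measurable_fun setT (fun y => H y * (v y)^-1%:E)%E.
  by apply: emeasurable_funM => //; exact/measurable_EFinP.
apply: ge0_le_integral => //.
- by move=> y _; exact: poweR_ge0.
- apply: measurable_poweRX.
  apply: emeasurable_funM; first exact/measurable_EFinP.
  exact: measurable_emaxop.
- apply: emeasurable_funM => //.
  apply: measurable_poweRX.
  by apply: emeasurable_funM => //; exact/measurable_EFinP.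
move=> x _.
have -> : (i%:E = ((i `^ t^-1)%:E) `^ t)%E.
  by rewrite poweR_EFin -powRrM mulVf// powRr1 ?ltW.
rewrite -poweRM ?lee_fin//; last first.
  by rewrite mule_ge0//; apply: emaxop_ge0 => // y; rewrite lee_fin.
apply: lee_poweR; first exact: ltW.
  rewrite mule_ge0//; apply: emaxop_ge0 => // y.
  by rewrite mule_ge0 ?lee_fin.
rewrite muleA [leRHS]muleC lee_wpmul2l//.
apply: le_emaxop => // U UU1.
have mU := basis_measurable HUU UU1.
rewrite -ge0_integralZl_EFin//; last 2 first.
- by move=> y _; rewrite lee_fin.
- by apply/measurable_EFinP/measurable_funTS.
rewrite le_eqVlt; apply/orP; left; apply/eqP; apply: ge0_ae_eq_integral => //.
- exact: measurable_funTS.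
- by apply: measurable_funTS; apply: emeasurable_funM => //; exact/measurable_EFinP.
- by move=> y _; rewrite mule_ge0 ?lee_fin.
- by move=> y _; rewrite mule_ge0 ?lee_fin.
apply: filterS Hfin => y Hy _ /=; rewrite /f -{1}(fineK Hy) -!EFinM mulrA.
by rewrite powRN !mulrA mulfV ?mul1r// gt_eqF ?powR_gt0.
Qed.

(* Instead of summing the Neumann series of the maximal operator one takes the
   supremum of the iterates of H |-> max(h, w M(H/v)/c).  Since t >= 1, the
   resulting constant 1/(1 - kappa'^-t) is at most kappa^t. *)
Lemma rubio_de_francia (t kappa : R) (v w : X -> R) (k : X -> R) :
  1 <= t -> 1 < kappa -> weight v -> weight w ->
  (maxop_norm mu UU t%:E v w < +oo)%E ->
  measurable_fun setT k -> (forall y, 0 <= k y) ->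
  (\int[mu]_y (k y)%:E = 1)%E ->
  let c := kappa / (kappa - 1) * fine (maxop_norm mu UU t%:E v w) in
  0 < c /\
  exists K : X -> R, [/\ weight K, {ae mu, forall y, k y <= K y},
    (\int[mu]_y (K y)%:E <= (kappa `^ t)%:E)%E &
    forall U, UU U -> {ae mu, forall x, U x ->
      ((w x / fine (mu U))%:E * \int[mu]_(y in U) (K y `^ t^-1 / v y)%:E <=
       (c * K x `^ t^-1)%:E)%E}].
Proof.
move=> t1 kappa1 wv ww Ny mk k0 k1 c.
have t0 : 0 < t by lra.
have tn0 : t != 0 by rewrite gt_eqF.
have t'0 : 0 < t^-1 by rewrite invr_gt0.
have muT := basis_setT_gt0 HUU.
have [mv v0] := wv; have [mw w0] := ww.
have [mv' v'gt0] := weightV wv.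
have we0 y : (0 <= (w y)%:E)%E by rewrite lee_fin ltW.
have v'0 y : (0 <= ((v y)^-1)%:E)%E by rewrite lee_fin ltW.
have N0 : (0 <= maxop_norm mu UU t%:E v w)%E.
  apply: le_trans (Lnorm_ge0 mu t%:E _) _; last first.
    apply: ereal_sup_ubound; exists (cst 0) => //; split => //.
    rewrite /lpw (_ : (fun x => _) = cst 0%E) ?Lnorm0// ?eqe//.
    by apply/funext => x /=; rewrite mul0r.
have Nfin : maxop_norm mu UU t%:E v w \is a fin_num by rewrite ge0_fin_numE.
set N := fine (maxop_norm mu UU t%:E v w).
pose h y := k y `^ t^-1.
have h0 y : 0 <= h y by exact: powR_ge0.
have mh : measurable_fun setT h by exact: measurable_powRX.
have hk y : h y `^ t = k y by rewrite -powRrM mulVf// powRr1.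
pose A (H : X -> \bar R) := emaxop (fun y => H y * (v y)^-1%:E)%E.
have Hv0 (H : X -> \bar R) : (forall y, 0 <= H y)%E ->
    (forall y, 0 <= H y * (v y)^-1%:E)%E.
  by move=> H0 y; exact: mule_ge0.
have mHv (H : X -> \bar R) : measurable_fun setT H ->
    measurable_fun setT (fun y => H y * (v y)^-1%:E)%E.
  by move=> mH; apply: emeasurable_funM => //; exact/measurable_EFinP.
have A0 (H : X -> \bar R) x : (forall y, 0 <= H y)%E -> (0 <= A H x)%E.
  by move=> H0; apply: emaxop_ge0 => //; exact: Hv0.
have mA (H : X -> \bar R) : measurable_fun setT (A H) by exact: measurable_emaxop.
have leA (H H' : X -> \bar R) x : measurable_fun setT H -> measurable_fun setT H' ->
    (forall y, 0 <= H y)%E -> (forall y, H y <= H' y)%E -> (A H x <= A H' x)%E.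
  move=> mH mH' H0 HH'; rewrite -[leRHS]mul1e; apply: le_emaxop => //.
    by apply: Hv0 => y; exact: le_trans (HH' y).
  move=> U UU1; rewrite mul1e; apply: ge0_le_integral.
  - exact: (basis_measurable HUU UU1).
  - by move=> y _; exact: Hv0.
  - exact/measurable_funTS/mHv.
  - exact/measurable_funTS/mHv.
  - by move=> y _; rewrite lee_wpmul2r.
(* If h/v had integral zero, k would vanish almost everywhere, against [k1]. *)
have Ahpos x : (0 < A (EFin \o h) x)%E.
  apply: emaxop_gt0 => //.
  - by apply: mHv; exact/measurable_EFinP.
  - by apply: Hv0 => y; rewrite lee_fin.
  rewrite lt0e integral_ge0 ?andbT; last first.
    by move=> y _; apply: Hv0 => z; rewrite lee_fin.
  apply/eqP => i0.
  have : ae_eq mu setT (fun y => (h y)%:E * (v y)^-1%:E)%E (cst 0%E).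
    apply/(ae_eq_integral_abs mu measurableT); first by apply: mHv; exact/measurable_EFinP.
    rewrite -i0; apply: eq_integral => y _; rewrite gee0_abs//.
    by rewrite mule_ge0// lee_fin.
  move=> hv0; suff : (\int[mu]_y (k y)%:E = 0)%E.
    by rewrite k1 => /eqP; rewrite onee_eq0.
  rewrite -[RHS](integral0 mu setT); apply: ge0_ae_eq_integral => //.
  - exact/measurable_EFinP.
  - by move=> y _; rewrite lee_fin.
  apply: filterS hv0 => y /(_ I) /eqP; rewrite mule_eq0 !eqe invr_eq0 (gt_eqF (v0 y)) orbF.
  by move=> /eqP hy _; rewrite -hk hy powR0.
have bound (H : X -> \bar R) : measurable_fun setT H -> (forall y, 0 <= H y)%E ->
    (0 < \int[mu]_y (H y `^ t) < +oo)%E ->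
    (\int[mu]_x (((w x)%:E * A H x) `^ t) <=
     (N `^ t)%:E * \int[mu]_y (H y `^ t))%E.
  move=> mH H0 iH; rewrite -poweR_EFin fineK//; exact: emaxop_bound.
have ih : (\int[mu]_y ((h y)%:E `^ t) = 1)%E.
  by rewrite -k1; apply: eq_integral => y _; rewrite poweR_EFin hk.
(* If N were 0, the function w A(h) would vanish almost everywhere, yet it is positive at every
   point of a space of positive measure. *)
have Npos : 0 < N.
  rewrite lt0r fine_ge0// andbT; apply/eqP => Nz.
  have /bound : measurable_fun setT (EFin \o h) by exact/measurable_EFinP.
  rewrite /= ih Nz powR0// mul0e lte01 ltry => /(_ _ isT) H.
  have mwA : measurable_fun setT (fun x => ((w x)%:E * A (EFin \o h) x) `^ t)%E.
    apply: measurable_poweRX; apply: emeasurable_funM => //.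
    exact/measurable_EFinP.
  have : ae_eq mu setT (fun x => ((w x)%:E * A (EFin \o h) x) `^ t)%E (cst 0%E).
    apply/(ae_eq_integral_abs mu measurableT mwA).
    apply/eqP; rewrite eq_le integral_ge0// andbT.
    under eq_integral do rewrite gee0_abs ?poweR_ge0//.
    by apply: H => y; rewrite lee_fin.
  case=> Z [mZ Z0 subZ]; move: muT; rewrite (_ : setT = Z) ?Z0 ?ltxx//.
  apply/esym/seteqP; split => // x _; apply: subZ => /= /(_ I) /eqP.
  by rewrite gt_eqF// poweR_gt0// mule_gt0// lte_fin.
have kap' : 0 < kappa / (kappa - 1) by rewrite divr_gt0 ?subr_gt0//; lra.
have c0 : 0 < c by rewrite mulr_gt0.
split=> //.
(* [a] is 1/kappa', so N / c = a and 1 - a = 1/kappa. The number [S] below sums the geometric series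
   of a^t and solves S = 1 + a^t S; from (1 - a)^t <= 1 - a <= 1 - a^t follows S <= kappa^t. *)
pose a := (kappa - 1) / kappa.
have a0 : 0 < a by rewrite divr_gt0 ?subr_gt0//; lra.
have a1 : a < 1 by rewrite ltr_pdivrMr; lra.
have kaE : kappa = (1 - a)^-1.
  by rewrite /a; field; apply/andP; split; apply/eqP; lra.
have at1 : a `^ t <= a by apply: ge1r_powR => //; rewrite a0 ltW.
have at1' : 0 < 1 - a `^ t by lra.
pose S := (1 - a `^ t)^-1.
have S0 : 0 < S by rewrite invr_gt0.
have SE : 1 + a `^ t * S = S by rewrite /S; field; rewrite gt_eqF.
have Sk : S <= kappa `^ t.
  rewrite kaE -powR_inv1; last lra.
  rewrite -powRrM mulN1r powRN lef_pV2 ?posrE ?powR_gt0//; last lra.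
  apply: le_trans (_ : 1 - a <= _); last lra.
  by apply: ge1r_powR => //; apply/andP; split; lra.
pose step (H : X -> \bar R) x := maxe (h x)%:E ((w x / c)%:E * A H x)%E.
pose Hn n := iter n step (EFin \o h).
have wc0 x : (0 <= (w x / c)%:E)%E by rewrite lee_fin divr_ge0 ?ltW.
have hHn n x : ((h x)%:E <= Hn n x)%E.
  by case: n => [|n] //=; rewrite /step le_max lexx.
have Hn0 n x : (0 <= Hn n x)%E by apply: le_trans (hHn n x); rewrite lee_fin.
have mHn n : measurable_fun setT (Hn n).
  elim: n => [|n ih']; first exact/measurable_EFinP.
  apply: measurable_maxe; first exact/measurable_EFinP.
  apply: emeasurable_funM => //; apply/measurable_EFinP.
  exact: measurable_funM.
have ndHn x : nondecreasing_seq (Hn ^~ x).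
  apply/nondecreasing_seqP => n; elim: n x => [|n ihn] x; first exact: hHn 1%N x.
  rewrite /= /step ge_max !le_max lexx/=; apply/orP; right.
  by rewrite lee_wpmul2l//; apply: (leA (Hn n) (Hn n.+1)).
have Hn_ge1 n : (1 <= \int[mu]_y (Hn n y `^ t))%E.
  rewrite -ih; apply: ge0_le_integral => //.
  - by move=> y _; exact: poweR_ge0.
  - by apply: measurable_poweRX; exact/measurable_EFinP.
  - exact: measurable_poweRX.
  - by move=> y _; apply: lee_poweR; rewrite ?lee_fin ?(ltW t0).
(* The t-th power of a maximum is at most the sum of the t-th powers, and (N/c)^t = a^t; the bound
   therefore propagates as 1 + a^t S = S. *)
have Hn_leS n : (\int[mu]_y (Hn n y `^ t) <= S%:E)%E.
  elim: n => [|n ihn].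
    by rewrite /= ih lee_fin -SE lerDl mulr_ge0 ?powR_ge0// ltW.
  have iHn : (0 < \int[mu]_y (Hn n y `^ t) < +oo)%E.
    by rewrite (le_lt_trans ihn (ltry _)) andbT (lt_le_trans lte01 (Hn_ge1 n)).
  have mwA : measurable_fun setT (fun x => ((w x)%:E * A (Hn n) x) `^ t)%E.
    apply: measurable_poweRX; apply: emeasurable_funM => //.
    exact/measurable_EFinP.
  apply: (@le_trans _ _ (\int[mu]_y ((h y)%:E `^ t +
      (c `^ (- t))%:E * ((w y)%:E * A (Hn n) y) `^ t))%E).
    apply: ge0_le_integral => //.
    - by move=> y _; exact: poweR_ge0.
    - exact: (measurable_poweRX _ _ (mHn n.+1)).
    - apply: emeasurable_funD; last exact: emeasurable_funM.
      by apply: measurable_poweRX; exact/measurable_EFinP.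
    move=> y _.
    have -> : ((c `^ (- t))%:E * ((w y)%:E * A (Hn n) y) `^ t =
               ((w y / c)%:E * A (Hn n) y) `^ t)%E.
      rewrite [w y / c]mulrC EFinM -muleA [RHS]poweRM.
      - by rewrite poweR_EFin -powR_inv1 ?(ltW c0)// -powRrM mulN1r.
      - by rewrite lee_fin invr_ge0 ltW.
      - by rewrite mule_ge0// A0.
    rewrite /= /step maxEle; case: ifP => _; first by rewrite leeDr ?lee_fin ?powR_ge0.
    by rewrite leeDl ?poweR_ge0.
  rewrite ge0_integralD//; last 4 first.
  - by move=> y _; exact: poweR_ge0.
  - by apply: measurable_poweRX; exact/measurable_EFinP.
  - by move=> y _; rewrite mule_ge0 ?poweR_ge0// lee_fin powR_ge0.
  - exact: emeasurable_funM.
  rewrite ih ge0_integralZl_EFin ?powR_ge0//; last by move=> y _; exact: poweR_ge0.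
  rewrite -[S]SE EFinD leeD2l//.
  apply: le_trans (lee_wpmul2l _ (bound _ (mHn n) (Hn0 n) iHn)) _.
    by rewrite lee_fin powR_ge0.
  rewrite muleA -EFinM; apply: le_trans (lee_wpmul2l _ ihn) _.
    by rewrite lee_fin mulr_ge0 ?powR_ge0.
  rewrite -EFinM lee_fin (_ : c `^ (- t) * N `^ t = a `^ t)//.
  have -> : a = c^-1 * N.
    by rewrite /c -/N invfM invf_div -mulrA mulVf ?mulr1// gt_eqF.
  rewrite [RHS]powRM ?invr_ge0 ?(ltW c0) ?(ltW Npos)//; congr (_ * _).
  by rewrite -(powR_inv1 (ltW c0)) -powRrM mulN1r.
pose H x := ereal_sup (range (Hn ^~ x)).
have HnH n x : (Hn n x <= H x)%E by apply: ereal_sup_ubound; exists n.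
have H0 x : (0 <= H x)%E by exact: le_trans (Hn0 0%N x) (HnH _ _).
(* The initial h may vanish, but one application of the maximal operator makes the supremum positive
   everywhere, as a weight must be. *)
have Hpos x : (0 < H x)%E.
  apply: lt_le_trans (HnH 1%N x); rewrite /= /step lt_max; apply/orP; right.
  by rewrite mule_gt0// lte_fin divr_gt0.
have mH : measurable_fun setT H by exact: measurable_ereal_sup.
have iH : (\int[mu]_y (H y `^ t) <= S%:E)%E.
  under eq_integral do rewrite /H -ereal_sup_poweR//.
  apply: (@integral_ereal_sup _ _ _ mu setT (fun n y => Hn n y `^ t)%E) => //.
  - by move=> n; exact: measurable_poweRX.
  - by move=> n y; exact: poweR_ge0.
  - by move=> y m n mn; apply: lee_poweR => //; [exact: ltW|exact: ndHn].
have Hfin := ae_fin_poweR t0 mH H0 (le_lt_trans iH (ltry _)).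
(* On the null set where H is infinite, [fine] returns 0 and the indicator resets the value to 1, so
   that G is real and positive everywhere. *)
pose G x := fine (H x) + \1_[set y | H y = +oo%E] x.
have mG : measurable_fun setT G.
  apply: measurable_funD; first exact: measurableT_comp.
  apply: measurable_indic; rewrite -[X in measurable X]setTI.
  exact: (mH measurableT [set +oo%E]).
have GH x : H x \is a fin_num -> (G x)%:E = H x.
  move=> Hx; rewrite /G indicE memNset ?addr0 ?fineK//= => Hy.
  by move: Hx; rewrite Hy.
have G0 x : 0 < G x.
  have [Hx|Hx] := boolP (H x \is a fin_num); first by rewrite -lte_fin GH.
  have Hy : H x = +oo%E.
    by move: Hx; rewrite ge0_fin_numE// -leNgt leye_eq => /eqP.
  by rewrite /G Hy/= add0r indicE mem_set.
have Gt x : (G x `^ t) `^ t^-1 = G x.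
  by rewrite -powRrM mulfV// powRr1// ltW.
exists (fun x => G x `^ t); split.
- by split=> [|x]; [exact: measurable_powRX|exact: powR_gt0].
- apply: filterS Hfin => x Hx; rewrite -hk ge0_ler_powR ?nnegrE ?(ltW t0) ?(ltW (G0 x))//.
  by rewrite -lee_fin GH//; exact: HnH 0%N x.
- apply: le_trans (_ : S%:E <= _)%E; last by rewrite lee_fin.
  apply: le_trans iH; rewrite le_eqVlt; apply/orP; left; apply/eqP.
  apply: ge0_ae_eq_integral => //.
  - exact/measurable_EFinP/measurable_powRX.
  - exact: measurable_poweRX.
  - by move=> x _; rewrite lee_fin powR_ge0.
  - by move=> x _; exact: poweR_ge0.
  by apply: filterS Hfin => x Hx _; rewrite -GH// poweR_EFin.
move=> U UU1; have mU := basis_measurable HUU UU1; have U0 := basis_fin HUU UU1.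
have -> : (\int[mu]_(y in U) ((G y `^ t) `^ t^-1 / v y)%:E =
           \int[mu]_(y in U) (H y * (v y)^-1%:E))%E.
  apply: ge0_ae_eq_integral => //.
  - apply/measurable_EFinP/measurable_funTS; under eq_fun do rewrite Gt.
    exact: measurable_funM.
  - exact/measurable_funTS/mHv.
  - by move=> y _; rewrite lee_fin divr_ge0 ?powR_ge0// ltW.
  - by move=> y _; exact: Hv0.
  by apply: filterS Hfin => y Hy _; rewrite Gt EFinM GH.
apply: filterS Hfin => x Hx Ux; rewrite Gt [(c * _)%:E]EFinM GH//.
pose q := c * fine (mu U) / w x.
have q0 : 0 < q by rewrite divr_gt0// mulr_gt0.
(* The average of H_n/v over U is at most A(H_n)(x), and (w x / c) A(H_n)(x) <= H_(n+1)(x) <= H(x)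
   by construction of the step; the bound passes to the limit by monotone convergence. *)
have Hq : (\int[mu]_(y in U) (H y * (v y)^-1%:E) <= q%:E * H x)%E.
  apply: le_trans (_ : \int[mu]_(y in U)
      ereal_sup (range (fun n => Hn n y * (v y)^-1%:E)) <= _)%E.
    apply: ge0_le_integral => //.
    - by move=> y _; exact: Hv0.
    - exact/measurable_funTS/mHv.
    - apply: measurable_funTS.
      apply: (@measurable_ereal_sup _ _ _ (fun n y => Hn n y * (v y)^-1%:E)%E) => n.
      exact: mHv.
    move=> y _; rewrite lee_pdivrMr//; apply: ge_ereal_sup => _ [n _ <-].
    by rewrite -lee_pdivrMr//; apply: ereal_sup_ubound; exists n.
  apply: (@integral_ereal_sup _ _ _ mu U (fun n y => Hn n y * (v y)^-1%:E)%E) => //.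
  - by move=> n; exact: mHv.
  - by move=> n y; exact: Hv0.
  - by move=> y m n mn; rewrite lee_wpmul2r//; exact: ndHn.
  move=> n; apply: le_trans (lee_wpmul2l _ (HnH n.+1 x)); last by rewrite lee_fin ltW.
  rewrite /= /step; apply: le_trans (_ : q%:E * ((w x / c)%:E * A (Hn n) x) <= _)%E;
    last by rewrite lee_wpmul2l ?lee_fin ?(ltW q0)// le_max lexx orbT.
  rewrite muleA -EFinM (_ : q * _ = fine (mu U)); last first.
    by rewrite /q; field; rewrite !gt_eqF.
  rewrite -lee_pdivrMl//; exact: emaxop_ge.
apply: le_trans (lee_wpmul2l _ Hq) _; first by rewrite lee_fin divr_ge0// ltW.
rewrite muleA -EFinM (_ : _ * q = c)//.
by rewrite /q; field; rewrite !gt_eqF.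
Qed.

End RubioDeFrancia.

(** * Construction of the new weights *)

Section WeightConstruction.
Context {d : measure_display} {X : measurableType d} {R : realType}.
Variable mu : {measure set X -> \bar R}.
Variable UU : set (set X).
Hypothesis HUU : basis_of_sets mu UU.

Lemma ae_exists (P : X -> Prop) (U : set X) : measurable U -> (0 < mu U)%E ->
  {ae mu, forall x, P x} -> exists2 x, U x & P x.
Proof.
move=> mU U0 [Z [mZ Z0 subZ]]; apply: contrapT => nex.
have UZ : U `<=` Z by move=> x Ux; apply: subZ => Px; apply: nex; exists x.
by have := subset_measure0 mU mZ UZ Z0; move=> UE; move: U0; rewrite UE ltxx.
Qed.

(** Put th = it0/it1, b = g/it1 and alpha = 1/ia. Then b alpha = 1 - th, hence w K^(-g) = w^th
    (w^alpha K^(-1/t))^b, and similarly for 1/v. On a basis set of measure m let j be the integral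
    of K^(1/t) v^(-alpha). The iteration bounds w^alpha K^(-1/t) by m c / j, while Hoelder's
    inequality charges j^b for the factor (K^(1/t) v^(-alpha))^b. The powers of j cancel, and those
    of m combine because b = (1 - th) ia. *)
Lemma improved_weights_pos (g kappa : R) (s0 r0 s1 r1 : \bar R) (w v k : X -> R) :
  0 < g -> 1 < kappa ->
  (0 < s0)%E -> (0 < r0)%E -> (0 < s1)%E -> (0 < r1)%E ->
  recip s1 - recip s0 = g -> recip r0 - recip r1 = g ->
  weight w -> weight v -> (wchar mu UU s1 r1 w v < +oo)%E ->
  measurable_fun setT k -> (forall y, 0 <= k y) -> (\int[mu]_y (k y)%:E = 1)%E ->
  let ia := ialpha s0 r0 in
  let it1 := (recip s0 + g) / ia in let it0 := recip s0 / ia in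
  let N := maxop_norm mu UU (ext_of_recip it1)
             (fun x => v x `^ ia^-1) (fun x => w x `^ ia^-1) in
  (N < +oo)%E ->
  0 < it1 /\
  exists K : X -> R, [/\ weight K, {ae mu, forall y, k y <= K y},
    (\int[mu]_y (K y)%:E <= (kappa `^ it1^-1)%:E)%E &
    (wchar mu UU s0 r0 (fun x => w x * K x `^ (- g))%R
                       (fun x => v x * K x `^ (- g))%R <=
     ((kappa / (kappa - 1) * fine N) `^ (g / it1) *
      fine (wchar mu UU s1 r1 w v) `^ (it0 / it1))%:E)%E].
Proof.
move=> g0 kappa1 s00 r00 s10 r10 gs gr ww wv wcy mk k0 k1 ia it1 it0 N Ny.
have sig0 := recip_ge0 _ s00; have rho1 := recip_ge0 _ r10.
have iaE : ia = recip s1 + recip r1 by rewrite /ia /ialpha; lra.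
have s1E : recip s1 = recip s0 + g by lra.
have s1pos : 0 < recip s1 by lra.
have ia0 : 0 < ia by lra.
have it10 : 0 < it1 by rewrite /it1 -s1E divr_gt0.
split=> //.
pose t := it1^-1.
(* The sum of the reciprocals of s and r is the same for both indices, so t = 1 + (1/r1)/(1/s1). *)
have t1 : 1 <= t by rewrite /t /it1 invf_div -s1E ler_pdivlMr// mul1r; lra.
have t0 : 0 < t by lra.
have NE : N = maxop_norm mu UU t%:E (fun x => v x `^ ia^-1) (fun x => w x `^ ia^-1).
  by rewrite /N /ext_of_recip gt_eqF.
rewrite NE in Ny.
have wW := weight_powR ia^-1 ww; have wV := weight_powR ia^-1 wv.
have [c0 [K [wK kK iK HK]]] :=
  rubio_de_francia HUU t1 kappa1 wV wW Ny mk k0 k1.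
rewrite -NE in c0 HK; set c := (X in 0 < X) in c0 HK.
exists K; split => //.
have muT := basis_setT_gt0 HUU.
have [mK K0] := wK; have [mw w0] := ww; have [mv v0] := wv.
have [mV V0] := wV; have [mW W0] := wW.
pose b := g / it1; pose th := it0 / it1.
have b0 : 0 < b by rewrite divr_gt0.
have s0r0 : recip s0 + recip r0 != 0 by rewrite -/ia gt_eqF.
have s0g : recip s0 + g != 0 by rewrite gt_eqF// -s1E.
have thE : th = recip s0 / recip s1.
  by rewrite /th /it0 /it1 s1E /ia /ialpha; field; rewrite ?s0g ?s0r0.
have bia : b / ia = 1 - th.
  by rewrite thE /b /it1 s1E /ia /ialpha; field; rewrite ?s0g ?s0r0.
have th0 : 0 <= th by rewrite thE divr_ge0// ltW.
have rho0 : recip r0 = th * recip r1 + b.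
  have -> : recip r1 = recip r0 - g by lra.
  by rewrite thE /b /it1 s1E /ia /ialpha; field; rewrite ?s0g ?s0r0.
have sig1 : recip s0 = th * recip s1.
  by rewrite thE divfK// gt_eqF.
have bt : t^-1 * b = g by rewrite /b /t invrK mulrC divfK// gt_eqF.
have wch0 := wchar_ge0 HUU s1 r1 w v.
have wchfin : wchar mu UU s1 r1 w v \is a fin_num by rewrite ge0_fin_numE.
apply: ge_ereal_sup => _ [U UU1 <-].
have mU := basis_measurable HUU UU1; have m0 := basis_fin HUU UU1.
have m1U : measurable_fun setT (\1_U : X -> R) by exact: measurable_indic.
set m := fine (mu U) in m0 *.
rewrite !NrK// -!/(Nr _ _ _).
pose D y := K y `^ t^-1 / v y `^ ia^-1 * \1_U y.
have D0 y : 0 <= D y by rewrite !mulr_ge0 ?invr_ge0 ?powR_ge0.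
have mD : measurable_fun setT D.
  apply: measurable_funM => //; apply: measurable_funM; first exact: measurable_powRX.
  by have [] := weightV wV.
have JE : (\int[mu]_(y in U) (K y `^ t^-1 / v y `^ ia^-1)%:E = \int[mu]_y (D y)%:E)%E.
  rewrite integral_mkcond; apply: eq_integral => y _; rewrite patchE /D indicE.
  by case: (y \in U); rewrite ?mulr1 ?mulr0.
set J := (\int[mu]_y (D y)%:E)%E in JE.
have J0 : (0 < J)%E.
  rewrite lt0e integral_ge0 ?andbT; last by move=> y _; rewrite lee_fin.
  apply/eqP => Jz.
  have : ae_eq mu setT (EFin \o D) (cst 0%E).
    apply/(ae_eq_integral_abs mu measurableT); first exact/measurable_EFinP.
    by rewrite -Jz; apply: eq_integral => y _; rewrite /= ger0_norm.
  have muU0 : (0 < mu U)%E by rewrite (basis_muE HUU UU1) lte_fin.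
  move=> /(ae_exists mU muU0)[y Uy /(_ I)/eqP] /=.
  rewrite eqe gt_eqF// /D indicE mem_set// mulr1 divr_gt0 ?powR_gt0//.
have HU := HK U UU1; rewrite JE -/m in HU.
(* Some point of U satisfies the inequality of the iteration, whose right-hand side is finite
   there. *)
have Jy : (J < +oo)%E.
  have muU0 : (0 < mu U)%E by rewrite (basis_muE HUU UU1) lte_fin.
  have [x Ux /(_ Ux) Hx] := ae_exists mU muU0 HU.
  rewrite ltNge leye_eq; apply/negP => /eqP Jy; move: Hx.
  by rewrite Jy gt0_muley// lte_fin divr_gt0.
have Jfin : J \is a fin_num by rewrite ge0_fin_numE// ltW.
pose j := fine J.
have j0 : 0 < j by rewrite fine_gt0// J0.
have JjE : J = j%:E by rewrite fineK.
have split_pow z : 0 < z -> z = z `^ th * (z `^ ia^-1) `^ b.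
  move=> z0; rewrite -powRrM -powRD ?(gt_eqF z0) ?implybT// mulrC bia.
  by rewrite addrC subrK powRr1// ltW.
have Wb y := split_pow (w y) (w0 y).
have vb y : (v y)^-1 = (v y)^-1 `^ th * ((v y `^ ia^-1)^-1) `^ b.
  by rewrite -(powRV _ _ (ltW (v0 y))) -split_pow// invr_gt0.
have E1 : (Nr mu (recip s0) (fun x => w x * K x `^ (- g) * \1_U x)%R <=
    ((m * c / j) `^ b)%:E * Nr mu (recip s1) (fun x => w x * \1_U x)%R `^ th)%E.
  have wK0 : weight (fun x => w x * K x `^ (- g)).
    by apply: weightM => //; exact: weight_powR.
  apply: le_trans (_ : Nr mu (recip s0)
     (fun x => (m * c / j) `^ b * (w x `^ th * \1_U x))%R <= _)%E.
    apply: le_Nr => //.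
    - by apply: measurable_funM => //; case: wK0.
    - apply: measurable_funM => //; apply: measurable_funM => //.
      exact: measurable_powRX.
    apply: filterS HU => x Hx; rewrite indicE.
    have [xU|_] := boolP (x \in U); last by rewrite !mulr0.
    have := Hx (set_mem xU); rewrite JjE -EFinM lee_fin => {}Hx.
    rewrite !mulr1 !ger0_norm ?mulr_ge0 ?powR_ge0 ?(ltW (w0 x))//.
    rewrite {1}[w x]Wb [leRHS]mulrC -mulrA ler_wpM2l ?powR_ge0//.
    have mcj : 0 <= m * c / j by rewrite ltW// divr_gt0// mulr_gt0.
    rewrite powRN ler_pdivrMr ?powR_gt0//.
    have -> : K x `^ g = (K x `^ t^-1) `^ b by rewrite -powRrM bt.
    rewrite -powRM ?powR_ge0//.
    rewrite ge0_ler_powR ?nnegrE ?powR_ge0 ?(ltW b0)//.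
      exact: mulr_ge0 mcj (powR_ge0 _ _).
    have -> : w x `^ ia^-1 = m / j * (w x `^ ia^-1 / m * j).
      by field; rewrite !gt_eqF.
    rewrite [m * c / j]mulrAC -[leRHS]mulrA; apply: ler_wpM2l => //.
    by rewrite divr_ge0// ltW.
  apply: le_trans (le_NrZ _ _ _ _ _ _ _) _ => //.
  - exact: powR_ge0.
  - by apply: measurable_funM => //; exact: measurable_powRX.
  rewrite lee_wpmul2l ?lee_fin ?powR_ge0// sig1; apply: Nr_pow => //.
  - exact: ltW.
  - by move=> y; exact: ltW.
have E2 : (Nr mu (recip r0) (fun x => (v x * K x `^ (- g))^-1 * \1_U x)%R <=
    Nr mu (recip r1) (fun x => (v x)^-1 * \1_U x)%R `^ th * (j `^ b)%:E)%E.
  have [mv' v'0] := weightV wv.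
  rewrite rho0 (_ : (fun x => _) =
     (fun x => ((v x)^-1 `^ th * \1_U x) * D x `^ b)%R); last first.
    apply/funext => x; rewrite /D indicE; case: (x \in U); last first.
      by rewrite !mulr0 mul0r.
    rewrite !mulr1 powRM ?invr_ge0 ?powR_ge0// -powRrM bt mulrCA mulrA.
    rewrite -mulrA -vb invfM powRN invrK; exact: mulrC.
  apply: le_trans (Nr_holder _ _ _ _ _ _ b0 muT _ mD D0 J0) _.
  - by rewrite mulr_ge0.
  - by apply: measurable_funM => //; exact: measurable_powRX.
  rewrite -/J JjE poweR_EFin lee_wpmul2r ?lee_fin ?powR_ge0//.
  by apply: Nr_pow => // y; exact: ltW.
apply: le_trans (lee_pmul _ _ (lee_wpmul2l _ E1) E2) _.
- by rewrite mule_ge0 ?Nr_ge0// lee_fin powR_ge0.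
- exact: Nr_ge0.
- by rewrite lee_fin powR_ge0.
have {}wchU : (wchar mu UU s1 r1 w v >= (m `^ (- ia))%:E *
    Nr mu (recip s1) (fun x => w x * \1_U x)%R *
    Nr mu (recip r1) (fun x => (v x)^-1 * \1_U x)%R)%E.
  by apply: ereal_sup_ubound; exists U => //; rewrite !NrK// iaE.
set A := Nr mu (recip s1) _ in wchU *; set B := Nr mu (recip r1) _ in wchU *.
have A0 : (0 <= A)%E by exact: Nr_ge0.
have B0 : (0 <= B)%E by exact: Nr_ge0.
apply: le_trans (_ : (c `^ b)%:E * (wchar mu UU s1 r1 w v) `^ th <= _)%E; last first.
  by rewrite -{1}(fineK wchfin) poweR_EFin -EFinM.
apply: le_trans (lee_wpmul2l _ (lee_poweR _ _ _ th0 _ wchU)); last 2 first.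
- by rewrite lee_fin powR_ge0.
- by rewrite !mule_ge0// lee_fin powR_ge0.
rewrite !poweRM ?mule_ge0 ?lee_fin ?powR_ge0// poweR_EFin -powRrM.
rewrite le_eqVlt; apply/orP; left; apply/eqP.
move: (A `^ th)%E (B `^ th)%E => a' b'.
rewrite [(b' * _)%E]muleC [((_ `^ (- (_ + _)))%:E * _)%E]muleA muleACA.
rewrite -[(_ * a' * b')%E]muleA [RHS]muleA -!EFinM; congr (_%:E * _)%E.
have jm : 0 <= m * c / j by rewrite ltW// divr_gt0// mulr_gt0.
rewrite -mulrA -powRM ?(ltW j0)// divfK ?gt_eqF// powRM ?(ltW m0) ?(ltW c0)//.
rewrite mulrA -powRD ?(gt_eqF m0) ?implybT// mulrC; congr (_ * _ `^ _).
have -> : b = (1 - th) * ia by rewrite -bia divfK// gt_eqF.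
by rewrite (_ : recip s0 + recip r0 = ia)//; ring.
Qed.

End WeightConstruction.

(** * New weights for an increment of either sign *)

Section ImprovedWeights.
Context {d : measure_display} {X : measurableType d} {R : realType}.
Variable mu : {measure set X -> \bar R}.
Variable UU : set (set X).
Hypothesis HUU : basis_of_sets mu UU.

Lemma recip_inj (p q : \bar R) : (0 < p)%E -> (0 < q)%E -> recip p = recip q -> p = q.
Proof. by move=> p0 q0 pq; rewrite -(recipK _ p0) pq recipK. Qed.

Lemma wchar_swap (s r : \bar R) (w v : X -> R) :
  wchar mu UU r s (fun x => (v x)^-1) (fun x => (w x)^-1) = wchar mu UU s r w v.
Proof.
congr ereal_sup; apply: eq_imagel => U UU1.
rewrite [recip r + _]addrC -!muleA; congr (_ * _)%E; rewrite muleC.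
by congr (_ * _)%E; apply: eq_Lnorm => x; rewrite invrK.
Qed.

Lemma lpwE (p : \bar R) (v f : X -> R) : (0 < p)%E ->
  lpw mu p v f = Nr mu (recip p) (fun x => f x * v x).
Proof. exact: NrK. Qed.

(** The domain inclusion asks for new weights without prescribing a density; a normalized indicator
    of a basis set supplies one. *)
Lemma exists_density : exists k : X -> R,
  [/\ measurable_fun setT k, forall y, 0 <= k y & (\int[mu]_y (k y)%:E = 1)%E].
Proof.
have [e eE] := basis_enum HUU; have UUe : UU (e 0%N) by rewrite eE; exists 0%N.
have mU := basis_measurable HUU UUe; have U0 := basis_fin HUU UUe.
exists (fun y => (fine (mu (e 0%N)))^-1 * \1_(e 0%N) y); split.
- by apply: measurable_funM => //; exact: measurable_indic.
- by move=> y; rewrite mulr_ge0// invr_ge0 ltW.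
under eq_integral do rewrite EFinM.
rewrite ge0_integralZl_EFin ?invr_ge0 ?ltW//; last first.
  exact/measurable_EFinP/measurable_indic.
by rewrite integral_indic// setIT (basis_muE HUU UUe) -EFinM mulVf ?gt_eqF.
Qed.

(* If K dominates the density |h|^(1/x1)/|h|_(1/x1)^(1/x1), then multiplying h
   by K^(x0 - x1) lowers its exponent 1/x1 to 1/x0 without increasing the norm. *)
Lemma Nr_lower (x0 x1 : R) (h K : X -> R) : 0 <= x0 -> x0 < x1 ->
  measurable_fun setT h -> weight K ->
  (0 < \int[mu]_y (`|h y| `^ x1^-1)%:E < +oo)%E ->
  {ae mu, forall y, (fine (\int[mu]_y (`|h y| `^ x1^-1)%:E))^-1 *
                    `|h y| `^ x1^-1 <= K y} ->
  (Nr mu x0 (fun y => h y * K y `^ (- (x1 - x0)))%R <= Nr mu x1 h)%E.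
Proof.
move=> x00 x01 mh [mK K0] /andP[I0 Iy] hK.
have muT := basis_setT_gt0 HUU.
have x10 : 0 < x1 by exact: le_lt_trans x01.
set I := (\int[mu]_y _)%E in I0 Iy hK.
have Ifin : I \is a fin_num by rewrite ge0_fin_numE// ltW.
set i := fine I in hK.
have i0 : 0 < i by rewrite fine_gt0// I0.
have mabs : measurable_fun setT (fun y => `|h y|) by exact: measurableT_comp.
have m1T : measurable_fun setT (\1_setT : X -> R) by exact: measurable_indic.
have x10n : x1 != 0 by rewrite gt_eqF.
(* The lower bound on K leaves i^(x1-x0) |h|^(x0/x1). By [Nr_pow] the norm of this power at index x0
   is at most (i^x1)^(x0/x1), and the total is i^x1, the norm of h. *)
apply: le_trans (_ : Nr mu x0
   (fun y => i `^ (x1 - x0) * (`|h y| `^ (x0 / x1) * \1_setT y))%R <= _)%E.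
  apply: le_Nr => //.
  - by apply: measurable_funM => //; exact: measurable_powRX.
  - by apply: measurable_funM => //; apply: measurable_funM => //; exact: measurable_powRX.
  apply: filterS hK => y hKy.
  rewrite normrM (ger0_norm (powR_ge0 (K y) _)) [leRHS]ger0_norm ?mulr_ge0 ?powR_ge0//.
  rewrite indicT mulr1; have [->|hn0] := eqVneq (h y) 0.
    by rewrite normr0 mul0r mulr_ge0 ?powR_ge0.
  have hp : 0 < `|h y| by rewrite normr_gt0.
  rewrite powRN ler_pdivrMr ?powR_gt0//.
  apply: (@le_trans _ _ (i `^ (x1 - x0) * `|h y| `^ (x0 / x1) *
      (i^-1 * `|h y| `^ x1^-1) `^ (x1 - x0))); last first.
    rewrite ler_wpM2l ?mulr_ge0 ?powR_ge0// ge0_ler_powR ?nnegrE//.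
    - by rewrite subr_ge0 ltW.
    - by rewrite mulr_ge0 ?powR_ge0// invr_ge0 ltW.
    - exact: ltW.
  rewrite [X in _ <= _ * X]powRM ?powR_ge0 ?invr_ge0 ?(ltW i0)// powRV ?(ltW i0)//.
  rewrite mulrACA mulfV ?gt_eqF ?powR_gt0// mul1r -powRrM -powRD; last first.
    by rewrite (gt_eqF hp) implybT.
  by rewrite (_ : x0 / x1 + x1^-1 * (x1 - x0) = 1) ?powRr1//; field.
apply: le_trans (le_NrZ _ _ _ _ _ _ _) _ => //.
- exact: powR_ge0.
- by apply: measurable_funM => //; exact: measurable_powRX.
apply: le_trans (_ : (i `^ (x1 - x0))%:E *
   Nr mu x1 (fun y => `|h y| * \1_setT y)%R `^ (x0 / x1) <= _)%E.
  rewrite lee_wpmul2l ?lee_fin ?powR_ge0// -{1}(divfK x10n x0).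
  by apply: Nr_pow => //; [exact: ltW|rewrite divr_ge0// ltW].
have -> : Nr mu x1 (fun y => `|h y| * \1_setT y)%R = (i `^ x1)%:E.
  have IE : (\int[mu]_y (`| `|h y| * \1_setT y | `^ x1^-1)%:E = I)%E.
    by apply: eq_integral => y _; rewrite indicT mulr1 normr_id.
  by rewrite (NrE mu _ _ x10) IE -(fineK Ifin).
rewrite (NrE mu _ _ x10) -/I -(fineK Ifin) !poweR_EFin -EFinM lee_fin -powRrM -powRD; last first.
  by rewrite (gt_eqF i0) implybT.
by rewrite (_ : x1 - x0 + x1 * (x0 / x1) = x1)//; field.
Qed.

(** The power of kappa in the last estimate is what the norm of g costs; the rest of kappa^beta is
    paid later on the side of T, through the bound on the integral of K. The given k must be
    dominated when ig < 0; when ig > 0 the density comes from g, with k as a fallback. *)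
Lemma improved_weights (ig kappa : R) (s0 r0 s1 r1 p0 p1 : \bar R)
    (w v k g : X -> R) :
  1 < kappa -> (0 < s0)%E -> (0 < r0)%E -> (0 < s1)%E -> (0 < r1)%E ->
  (0 < p0)%E -> (0 < p1)%E ->
  recip p1 - recip p0 = ig ->
  recip s1 - recip s0 = ig -> recip r0 - recip r1 = ig ->
  weight w -> weight v -> (wchar mu UU s1 r1 w v < +oo)%E ->
  let it1 := recip_t ig s0 r0 in let it0 := recip_t0 ig s0 r0 in
  let N := maxop_norm mu UU (ext_of_recip it1) (vt ig s0 r0 w v) (wt ig s0 r0 w v) in
  (ig != 0 -> (N < +oo)%E) ->
  measurable_fun setT k -> (forall y, 0 <= k y) -> (\int[mu]_y (k y)%:E = 1)%E ->
  inLpw mu p1 v g ->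
  0 < it1 /\
  exists K : X -> R, weight K /\
    [/\ Wset mu UU ig s0 r0 w v (fun x => w x * K x `^ (- ig), fun x => v x * K x `^ (- ig)),
     (wchar mu UU s0 r0 (fun x => w x * K x `^ (- ig))%R
                        (fun x => v x * K x `^ (- ig))%R <=
      ((kappa / (kappa - 1) * fine N) `^ (`|ig| / it1) *
       fine (wchar mu UU s1 r1 w v) `^ (it0 / it1))%:E)%E,
     ig != 0 -> (0 < \int[mu]_y (K y)%:E)%E /\
                (\int[mu]_y (K y)%:E <= (kappa `^ it1^-1)%:E)%E,
     ig < 0 -> {ae mu, forall y, k y <= K y} &
     (lpw mu p0 (fun x => v x * K x `^ (- ig))%R g <=
      (kappa `^ (Num.max (- ig) 0 / it1))%:E * lpw mu p1 v g)%E].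
Proof.
move=> kappa1 s00 r00 s10 r10 p00 p10 gp gs gr ww wv wcy it1 it0 N HN mk k0 k1 [mg gy].
have muT := basis_setT_gt0 HUU.
have [mv v0] := wv; have [mw w0] := ww.
have wchfin : wchar mu UU s1 r1 w v \is a fin_num by rewrite ge0_fin_numE// wchar_ge0.
have Wset_neq0 K : ig != 0 -> weight K ->
    (wchar mu UU s0 r0 (fun x => w x * K x `^ (- ig))%R
                       (fun x => v x * K x `^ (- ig))%R < +oo)%E ->
    Wset mu UU ig s0 r0 w v (fun x => w x * K x `^ (- ig), fun x => v x * K x `^ (- ig)).
  move=> ign0 wK wy; rewrite /Wset (negbTE ign0) /=.
  have wK' := weight_powR (- ig) wK; have [_ K'0] := wK'.
  split; first exact: weightM.
  split; first exact: weightM.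
  split=> // x; rewrite invfM mulrACA mulfV ?mulr1//; exact: lt0r_neq0 (K'0 x).
have int_gt0 (K h : X -> R) : weight K -> measurable_fun setT h -> (forall y, 0 <= h y) ->
    (\int[mu]_y (h y)%:E = 1)%E -> {ae mu, forall y, h y <= K y} ->
    (0 < \int[mu]_y (K y)%:E)%E.
  move=> [mK K0] mh h0 h1 hK; apply: (@lt_le_trans _ _ 1%E); first exact: lte01.
  rewrite -h1; apply: ae_ge0_le_integral => //.
  - by move=> y _; rewrite lee_fin.
  - exact/measurable_EFinP.
  - by move=> y _; rewrite lee_fin ltW.
  - exact/measurable_EFinP.
  - by apply: filterS hK => y hKy _; rewrite lee_fin.
have [ig0|[ig0|ig0]] : ig < 0 \/ 0 < ig \/ ig = 0.
  by case: (ltgtP ig 0) => H; [left|right; left|right; right].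
- have [it10 [K [wK kK iK HK]]] : 0 < it1 /\
      exists K : X -> R, [/\ weight K, {ae mu, forall y, k y <= K y},
    (\int[mu]_y (K y)%:E <= (kappa `^ it1^-1)%:E)%E &
    (wchar mu UU s0 r0 (fun x => w x * K x `^ (- ig))%R
                       (fun x => v x * K x `^ (- ig))%R <=
     ((kappa / (kappa - 1) * fine N) `^ (`|ig| / it1) *
      fine (wchar mu UU s1 r1 w v) `^ (it0 / it1))%:E)%E].
    (* Under (w, v, s, r) -> (1/v, 1/w, r, s) the increment becomes -ig, and the exponents and
       rescaled weights of the positive case become those prescribed for ig < 0. *)
    have nig0 : 0 < - ig by rewrite oppr_gt0.
    have gr' : recip r1 - recip r0 = - ig by lra.
    have gs' : recip s0 - recip s1 = - ig by lra.
    have wcy' : (wchar mu UU r1 s1 (fun x => (v x)^-1)%R (fun x => (w x)^-1)%R < +oo)%E.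
      by rewrite wchar_swap.
    have it1E : (recip r0 + - ig) / ialpha r0 s0 = it1.
      by rewrite /it1 /recip_t ltNge (ltW ig0)/= ig0 /ialpha addrC [recip r0 + recip s0]addrC addrC.
    have it0E : recip r0 / ialpha r0 s0 = it0.
      by rewrite /it0 /recip_t0 ltNge (ltW ig0)/= ig0 /ialpha addrC.
    have vtE : (fun x => (w x)^-1 `^ (ialpha r0 s0)^-1) = vt ig s0 r0 w v.
      apply/funext => x; rewrite /vt ltNge (ltW ig0)/= powRV ?(ltW (w0 x))// -powRN.
      by rewrite /ialpha addrC.
    have wtE : (fun x => (v x)^-1 `^ (ialpha r0 s0)^-1) = wt ig s0 r0 w v.
      apply/funext => x; rewrite /wt ltNge (ltW ig0)/= powRV ?(ltW (v0 x))// -powRN.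
      by rewrite /ialpha addrC.
    have := improved_weights_pos HUU nig0 kappa1 r00 s00 r10 s10 gr' gs'
      (weightV wv) (weightV ww) wcy' mk k0 k1.
    rewrite /= it1E it0E vtE wtE -/N => /(_ (HN (ltr0_neq0 ig0)))[it10 [K [wK kK iK HK]]].
    split; first exact: it10.
    exists K; split; [exact: wK|exact: kK|exact: iK|].
    rewrite (ltr0_norm ig0) -(wchar_swap s1 r1 w v) -[leLHS]wchar_swap.
    have EE (u : X -> R) : (fun x => (u x * K x `^ (- ig))^-1) =
        (fun x => (u x)^-1 * K x `^ (- - ig)).
      by apply/funext => x; rewrite invfM powRN invrK opprK.
    rewrite !EE; exact: HK.
  split; first exact: it10.
  exists K; split; first exact: wK.
  have [mK K0] := wK.
  have iK0 := int_gt0 _ _ wK mk k0 k1 kK.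
  split=> //.
  - by apply: Wset_neq0 => //; [exact: ltr0_neq0|exact: le_lt_trans HK (ltry _)].
  (* The index grows by |ig|, so Hoelder's inequality pays the power |ig| of the integral of K,
     which is at most kappa^(1/it1). *)
  rewrite !lpwE// (_ : recip p0 = recip p1 + - ig); last by lra.
  have -> : (fun x => g x * (v x * K x `^ (- ig))) =
            (fun x => (g x * v x) * K x `^ (- ig)).
    by apply/funext => x; rewrite mulrA.
  apply: le_trans (Nr_holder _ _ _ _ _ _ _ _ _ _ _ _) _ => //.
  - exact: recip_ge0.
  - by rewrite oppr_gt0.
  - exact: measurable_funM.
  - by move=> y; exact: ltW.
  rewrite muleC lee_wpmul2r ?Nr_ge0//.
  apply: le_trans (lee_poweR _ _ _ _ _ iK) _.
  - by rewrite oppr_ge0 ltW.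
  - exact: ltW.
  have nig0 : 0 <= - ig by rewrite oppr_ge0 ltW.
  by rewrite poweR_EFin lee_fin -powRrM mulrC (max_l nig0).
- pose h y := g y * v y.
  have mh : measurable_fun setT h by exact: measurable_funM.
  have x00 := recip_ge0 _ p00.
  have x10 : 0 < recip p1 by lra.
  pose I := (\int[mu]_y (`|h y| `^ (recip p1)^-1)%:E)%E.
  have I0 : (0 <= I)%E by apply: integral_ge0 => y _; rewrite lee_fin powR_ge0.
  have Iy : (I < +oo)%E.
    move: gy; rewrite lpwE// NrE//; apply: lty_poweRy; exact: lt0r_neq0.
  have Ifin : I \is a fin_num by rewrite ge0_fin_numE.
  (* If g v vanishes almost everywhere, its power cannot be normalized and [k] replaces it. *)
  have [k' [mk' k'0 k'1 k'h]] : exists k' : X -> R, [/\ measurable_fun setT k',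
      forall y, 0 <= k' y, (\int[mu]_y (k' y)%:E = 1)%E &
      (0 < I)%E -> k' = (fun y => (fine I)^-1 * `|h y| `^ (recip p1)^-1)].
    have [I00|In0] := eqVneq I 0%E; first by exists k; rewrite I00 ltxx.
    have i0 : 0 < fine I by rewrite fine_gt0// lt0e In0 I0 Iy.
    exists (fun y => (fine I)^-1 * `|h y| `^ (recip p1)^-1); split=> //.
    - by apply: measurable_funM => //; exact: measurable_absX.
    - by move=> y; rewrite mulr_ge0 ?powR_ge0// invr_ge0 ltW.
    under eq_integral do rewrite EFinM.
    rewrite ge0_integralZl_EFin ?invr_ge0 ?ltW//; last first.
      exact/measurable_EFinP/measurable_absX.
    by rewrite -/I -(fineK Ifin) -EFinM mulVf ?gt_eqF.
  have it1E : (recip s0 + ig) / ialpha s0 r0 = it1 by rewrite /it1 /recip_t ig0.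
  have it0E : recip s0 / ialpha s0 r0 = it0 by rewrite /it0 /recip_t0 ig0.
  have vtE : (fun x => v x `^ (ialpha s0 r0)^-1) = vt ig s0 r0 w v.
    by rewrite /vt ig0.
  have wtE : (fun x => w x `^ (ialpha s0 r0)^-1) = wt ig s0 r0 w v.
    by rewrite /wt ig0.
  have := improved_weights_pos HUU ig0 kappa1 s00 r00 s10 r10 gs gr
      ww wv wcy mk' k'0 k'1.
  rewrite /= it1E it0E vtE wtE -/N => /(_ (HN (lt0r_neq0 ig0)))[it10 [K [wK kK iK HK]]].
  split=> //; exists K; split=> //; have [mK K0] := wK.
  have iK0 := int_gt0 _ _ wK mk' k'0 k'1 kK.
  split=> //.
  - by apply: Wset_neq0 => //; [exact: lt0r_neq0|exact: le_lt_trans HK (ltry _)].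
  - by rewrite gtr0_norm.
  - by move=> ig0'; move: (lt_trans ig0 ig0'); rewrite ltxx.
  rewrite max_r ?oppr_le0 ?(ltW ig0)// mul0r powRr0 mul1e !lpwE//.
  have -> : (fun x => g x * (v x * K x `^ (- ig))) =
            (fun x => h x * K x `^ (- (recip p1 - recip p0))).
    by apply/funext => x; rewrite mulrA gp.
  have [I00|In0] := eqVneq I 0%E.
    apply: le_trans (_ : Nr mu (recip p0) (fun y => 0 * h y)%R <= _)%E.
      apply: le_Nr => //.
      - by apply: measurable_funM => //; exact: measurable_powRX.
      - exact: measurable_funM.
      have : ae_eq mu setT (fun y => (`|h y| `^ (recip p1)^-1)%:E) (cst 0%E).
        apply/(ae_eq_integral_abs mu measurableT).
          exact/measurable_EFinP/measurable_absX.
        by rewrite -I00; apply: eq_integral => y _; rewrite gee0_abs// lee_fin powR_ge0.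
      apply: filterS => y /(_ Logic.I)/eqP; rewrite eqe => /eqP/powR_eq0_eq0/normr0_eq0 ->.
      by rewrite !mul0r.
    apply: le_trans (le_NrZ _ _ _ _ _ _ _) _ => //.
    by rewrite mul0e Nr_ge0.
  have Ipos : (0 < I)%E by rewrite lt0e In0.
  apply: Nr_lower => //; first by lra.
  - by rewrite -/I Ipos Iy.
  - by move: kK; rewrite (k'h Ipos).
(* For ig = 0 the exponents coincide in pairs, and K = 1 returns the original weights. *)
have p01 : p0 = p1 by apply: recip_inj => //; lra.
have s01 : s0 = s1 by apply: recip_inj => //; lra.
have r01 : r0 = r1 by apply: recip_inj => //; lra.
have it11 : it1 = 1 by rewrite /it1 /recip_t ig0 ltxx.
have it01 : it0 = 1 by rewrite /it0 /recip_t0 ig0 ltxx.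
split; first by rewrite it11.
have EE (u : X -> R) : (fun x => u x * (cst 1 x : R) `^ (- ig)) = u.
  by apply/funext => x; rewrite powR1 mulr1.
exists (cst 1); split; first by split=> // x; exact: ltr01.
rewrite !EE; split.
- by rewrite /Wset ig0 eqxx.
- rewrite it11 it01 ig0 normr0 mul0r divr1 powRr0 mul1r powRr1 ?fine_ge0 ?wchar_ge0//.
  by rewrite fineK// s01 r01.
- by rewrite ig0 eqxx.
- by rewrite ig0 ltxx.
by rewrite ig0 oppr0 maxxx mul0r powRr0 mul1e p01.
Qed.

End ImprovedWeights.

(** * Extrapolation *)

Section Products.
Context {R : realType}.

Lemma maxr0_sub (x : R) : x = Num.max x 0 - Num.max (- x) 0.
Proof.
case/orP: (le_total 0 x) => x0.
  by rewrite (max_l x0) max_r ?subr0// oppr_le0.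
by rewrite (max_r x0) max_l ?sub0r ?opprK// oppr_ge0.
Qed.

Lemma maxr0_add (x : R) : `|x| = Num.max x 0 + Num.max (- x) 0.
Proof.
case/orP: (le_total 0 x) => x0.
  by rewrite (max_l x0) max_r ?addr0 ?ger0_norm// oppr_le0.
by rewrite (max_r x0) max_l ?add0r ?ler0_norm// oppr_ge0.
Qed.

(** Nonnegative exponents make the law of exponents valid at base 0 too, which is needed at the
    zeros of a density. *)
Lemma powRD_ge0 (x r s : R) : 0 <= r -> 0 <= s -> x `^ (r + s) = x `^ r * x `^ s.
Proof.
move=> r0 s0; have [rs0|rs0] := eqVneq (r + s) 0; last first.
  by rewrite powRD// (negbTE rs0).
have -> : r = 0 by lra.
have -> : s = 0 by lra.
by rewrite addr0 powRr0 mulr1.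
Qed.

Lemma powR_sum (I : Type) (s : seq I) (x : R) (e : I -> R) : (forall j, 0 <= e j) ->
  x `^ (\sum_(j <- s) e j) = \prod_(j <- s) x `^ e j.
Proof.
move=> e0; elim: s => [|i s ih]; first by rewrite !big_nil powRr0.
by rewrite !big_cons powRD_ge0 ?ih// sumr_ge0.
Qed.

(** Coordinates are switched from [A] to [C] one at a time along a list; a repeated index changes
    nothing. *)
Lemma le_monotone_coord (n : nat) (phi : ('I_n -> R) -> R) (A C : 'I_n -> R) :
  (forall (x : 'I_n -> R) (j : 'I_n) (a b : R), a <= b ->
     phi (fun k => if k == j then a else x k) <= phi (fun k => if k == j then b else x k)) ->
  (forall j, A j <= C j) -> phi A <= phi C.
Proof.
move=> Hphi AC; pose h (s : seq 'I_n) j := if j \in s then C j else A j.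
suff H s : phi A <= phi (h s).
  rewrite (_ : C = h (enum 'I_n)) ?H//.
  by apply/funext => j; rewrite /h mem_enum.
elim: s => [|i s ih]; first by rewrite (_ : h [::] = A).
apply: le_trans ih _; have [is_|is_] := boolP (i \in s).
  rewrite (_ : h (i :: s) = h s)//; apply/funext => j; rewrite /h inE.
  by case: eqP => [->|//]; rewrite is_.
have -> : h s = (fun k => if k == i then A i else h s k).
  by apply/funext => k; case: eqP => [->|//]; rewrite /h (negbTE is_).
have -> : h (i :: s) = (fun k => if k == i then C i else h s k).
  by apply/funext => k; rewrite /h inE; case: eqP => [->|].
exact: Hphi.
Qed.

End Products.

Section HolderProduct.
Context {d : measure_display} {X : measurableType d} {R : realType}.
Variable mu : {measure set X -> \bar R}.

Lemma weight_prod (I : Type) (s : seq I) (w : I -> X -> R) :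
  (forall j, weight (w j)) -> weight (fun y => \prod_(j <- s) w j y).
Proof.
move=> ww; elim: s => [|i s ih].
  rewrite (_ : (fun y => _) = cst 1); last by apply/funext => y; rewrite big_nil.
  by split=> // y; exact: ltr01.
rewrite (_ : (fun y => _) = (fun y => w i y * \prod_(j <- s) w j y)).
  exact: weightM.
by apply/funext => y; rewrite big_cons.
Qed.

(** One application of Hoelder's inequality per factor. Factors with exponent 0 are skipped, since
    the integral of their [K j] is not controlled. *)
Lemma Nr_holder_prod (I : Type) (s : seq I) (x : R) (e M : I -> R) (G : X -> R)
    (K : I -> X -> R) :
  0 <= x -> (0 < mu setT)%E -> measurable_fun setT G ->
  (forall j, weight (K j)) -> (forall j, 0 <= e j) -> (forall j, 0 <= M j) ->
  (forall j, 0 < e j -> (0 < \int[mu]_y (K j y)%:E)%E /\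
                        (\int[mu]_y (K j y)%:E <= (M j)%:E)%E) ->
  (Nr mu (x + \sum_(j <- s) e j) (fun y => G y * \prod_(j <- s) K j y `^ e j)%R <=
   Nr mu x G * (\prod_(j <- s) M j `^ e j)%:E)%E.
Proof.
move=> x0 muT mG wK e0 M0 HK; elim: s => [|i s ih].
  rewrite !big_nil addr0 mule1.
  by rewrite (_ : (fun y => _) = G)//; apply/funext => y; rewrite big_nil mulr1.
have sum0 : 0 <= \sum_(j <- s) e j by rewrite sumr_ge0.
have [mK K0] := wK i.
have mGs : measurable_fun setT (fun y => G y * \prod_(j <- s) K j y `^ e j).
  apply: measurable_funM => //.
  by have [] := weight_prod s (fun j => weight_powR (e j) (wK j)).
rewrite !big_cons; have [ei0|ei0] := eqVneq (e i) 0.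
  rewrite ei0 add0r powRr0 mul1r; apply: le_trans ih.
  rewrite le_eqVlt; apply/orP; left; apply/eqP; congr (Nr _ _ _).
  by apply/funext => y; rewrite big_cons ei0 powRr0 mul1r.
have eip : 0 < e i by rewrite lt0r ei0 e0.
have [iK0 iKM] := HK i eip.
rewrite [e i + _]addrC addrA.
have -> : (fun y => G y * \prod_(j <- i :: s) K j y `^ e j) =
          (fun y => (G y * \prod_(j <- s) K j y `^ e j) * K i y `^ e i).
  by apply/funext => y; rewrite big_cons mulrCA mulrC.
apply: le_trans (Nr_holder _ _ _ _ _ _ eip muT mGs mK _ iK0) _.
- by rewrite addr_ge0.
- by move=> y; exact: ltW.
rewrite mulrC EFinM muleA; apply: lee_pmul => //.
- exact: Nr_ge0.
- exact: poweR_ge0.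
rewrite -poweR_EFin; apply: lee_poweR => //; exact: ltW.
Qed.

End HolderProduct.

Unset Implicit Arguments.
Set Strict Implicit.

Theorem theorem2p6
  (d : measure_display) (X : measurableType d) (R : realType)
  (mu : {measure set X -> \bar R}) (Hsf : sigma_finite setT mu)
  (UU : set (set X)) (HUU : basis_of_sets mu UU)
  (m : nat) (q0 q1 : \bar R) (p0 p1 s0 s1 r0 r1 : 'I_m -> \bar R)
  (ig : 'I_m -> R) (* ig j = 1/gamma_j *)
  (Hq0 : (0 < q0)%E) (Hq1 : (0 < q1)%E)
  (Hp0 : forall j, (0 < p0 j)%E) (Hp1 : forall j, (0 < p1 j)%E)
  (Hs0 : forall j, (0 < s0 j)%E) (Hs1 : forall j, (0 < s1 j)%E)
  (Hr0 : forall j, (0 < r0 j)%E) (Hr1 : forall j, (0 < r1 j)%E)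
  (Hgp : forall j, recip (p1 j) - recip (p0 j) = ig j)
  (Hgs : forall j, recip (s1 j) - recip (s0 j) = ig j)
  (Hgr : forall j, recip (r0 j) - recip (r1 j) = ig j)
  (Hgq : recip q1 - recip q0 = \sum_(j < m) ig j)
  (w1 v1 : 'I_m -> X -> R)
  (Hw1 : forall j, weight (w1 j)) (Hv1 : forall j, weight (v1 j))
  (Hc1 : forall j, (wchar mu UU (s1 j) (r1 j) (w1 j) (v1 j) < +oo)%E)
  (* (i): M bounded from L^{t_1j}_{v_{t_1j}} to L^{t_1j}_{w_{t_1j}}
     (regarded as satisfied when 1/gamma_j = 0) *)
  (HM : forall j, ig j != 0 ->
     (maxop_norm mu UU (ext_of_recip (recip_t (ig j) (s0 j) (r0 j)))
        (vt (ig j) (s0 j) (r0 j) (w1 j) (v1 j))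
        (wt (ig j) (s0 j) (r0 j) (w1 j) (v1 j)) < +oo)%E)
  (* (ii) *)
  (V : 'I_m -> Type) (S : forall j, V j -> X -> R)
  (HS : forall j (x : V j), measurable_fun setT (S j x))
  (T : (forall j, V j) -> X -> R)
  (HT : forall f : (forall j, V j),
     (forall j, exists2 wv, Wset mu UU (ig j) (s0 j) (r0 j) (w1 j) (v1 j) wv
                          & inLpw mu (p0 j) wv.2 (S j (f j))) ->
     measurable_fun setT (T f))
  (phi : ('I_m -> R) -> R)
  (Hphi : forall (x : 'I_m -> R) (j : 'I_m) (a b : R), a <= b ->
     phi (fun k => if k == j then a else x k) <= phi (fun k => if k == j then b else x k))
  (Hbound : forall w0 v0 : 'I_m -> X -> R,
     (forall j, Wset mu UU (ig j) (s0 j) (r0 j) (w1 j) (v1 j) (w0 j, v0 j)) ->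
     forall f : (forall j, V j),
     (forall j, inLpw mu (p0 j) (v0 j) (S j (f j))) ->
     (lpw mu q0 (fun x => (\prod_(j < m) w0 j x)%R) (T f)
      <= (phi (fun j => fine (wchar mu UU (s0 j) (r0 j) (w0 j) (v0 j)))
          * \prod_(j < m) fine (lpw mu (p0 j) (v0 j) (S j (f j))))%:E)%E) :
  (forall f : (forall j, V j),
     (forall j, inLpw mu (p1 j) (v1 j) (S j (f j))) ->
     forall j, exists2 wv, Wset mu UU (ig j) (s0 j) (r0 j) (w1 j) (v1 j) wv
                         & inLpw mu (p0 j) wv.2 (S j (f j)))
  /\
  (forall kappa : R, 1 < kappa ->
   forall f : (forall j, V j),
     (forall j, inLpw mu (p1 j) (v1 j) (S j (f j))) ->
     let it1 j := recip_t (ig j) (s0 j) (r0 j) in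
     let it0 j := recip_t0 (ig j) (s0 j) (r0 j) in
     let ex j := `|ig j| / it1 j in (* t_1j / |gamma_j| *)
     let beta := \sum_(j < m) ex j in
     let kappa' := kappa / (kappa - 1) in
     let C j :=
       (kappa' * fine (maxop_norm mu UU (ext_of_recip (it1 j))
                         (vt (ig j) (s0 j) (r0 j) (w1 j) (v1 j))
                         (wt (ig j) (s0 j) (r0 j) (w1 j) (v1 j)))) `^ ex j
       * fine (wchar mu UU (s1 j) (r1 j) (w1 j) (v1 j)) `^ (it0 j / it1 j) in
     (lpw mu q1 (fun x => (\prod_(j < m) w1 j x)%R) (T f)
      <= (kappa `^ beta * phi C
          * \prod_(j < m) fine (lpw mu (p1 j) (v1 j) (S j (f j))))%:E)%E).
Proof.
have muT := basis_setT_gt0 HUU.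
split.
  move=> f Hf j; have [k [mk k0 k1]] := exists_density HUU.
  (* Any kappa > 1 serves here, because only finiteness of the new norm is wanted. *)
  have two : (1 : R) < 2 by lra.
  have [_ [K [wK [WK _ _ _ nK]]]] := improved_weights HUU two (Hs0 j) (Hr0 j)
    (Hs1 j) (Hr1 j) (Hp0 j) (Hp1 j) (Hgp j) (Hgs j) (Hgr j) (Hw1 j) (Hv1 j) (Hc1 j)
    (HM j) mk k0 k1 (Hf j).
  exists (fun x => w1 j x * K x `^ (- ig j), fun x => v1 j x * K x `^ (- ig j)) => //=.
  split; first exact: HS.
  apply: le_lt_trans nK _; apply: lte_mul_pinfty => //.
  by have [] := Hf j.
move=> kappa kappa1 f Hf.
pose it1 j := recip_t (ig j) (s0 j) (r0 j).
pose it0 j := recip_t0 (ig j) (s0 j) (r0 j).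
pose ex j := `|ig j| / it1 j.
pose beta := \sum_(j < m) ex j.
pose C j :=
  (kappa / (kappa - 1) * fine (maxop_norm mu UU (ext_of_recip (it1 j))
                    (vt (ig j) (s0 j) (r0 j) (w1 j) (v1 j))
                    (wt (ig j) (s0 j) (r0 j) (w1 j) (v1 j)))) `^ ex j
  * fine (wchar mu UU (s1 j) (r1 j) (w1 j) (v1 j)) `^ (it0 j / it1 j).
change (lpw mu q1 (fun x => (\prod_(j < m) w1 j x)%R) (T f)
      <= (kappa `^ beta * phi C
          * \prod_(j < m) fine (lpw mu (p1 j) (v1 j) (S j (f j))))%:E)%E.
have kap0 : 0 < kappa by lra.
pose Q j := fine (lpw mu (p1 j) (v1 j) (S j (f j))).
have Q0 j : 0 <= Q j by rewrite fine_ge0// Lnorm_ge0.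
have QE j : lpw mu (p1 j) (v1 j) (S j (f j)) = (Q j)%:E.
  by rewrite fineK// ge0_fin_numE ?Lnorm_ge0//; have [] := Hf j.
(* The part [n] is handled by duality against k^a, the part [e] by Hoelder's inequality against the
   K_j with positive increment. *)
pose n j := Num.max (- ig j) 0; pose e j := Num.max (ig j) 0.
have n0 j : 0 <= n j by rewrite le_max lexx orbT.
have e0 j : 0 <= e j by rewrite le_max lexx orbT.
have igE j : ig j = e j - n j by exact: maxr0_sub.
have nigE j : `|ig j| = e j + n j by exact: maxr0_add.
pose a := \sum_(j < m) n j.
pose W1 x := \prod_(j < m) w1 j x.
have wW1 : weight W1 by exact: weight_prod.
pose F x := T f x * W1 x.
have x1 : 0 <= recip q1 by exact: recip_ge0.
have x0 : 0 <= recip q0 by exact: recip_ge0.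
(* The two routes meet at this index: F k^a is measured at 1/q1 + a, and G times the product of the
   K_j^(e j) at 1/q0 plus the sum of the e j. *)
have xE : recip q1 + a = recip q0 + \sum_(j < m) e j.
  have -> : recip q1 = recip q0 + \sum_(j < m) ig j by lra.
  under eq_bigr do rewrite igE.
  by rewrite sumrB /a; lra.
pose RHS := kappa `^ beta * phi C * \prod_(j < m) Q j.
(* The weights depend on k, but the bound [RHS] does not. Measurability of T f also comes from here,
   since the constructed weights place f in the domain of T. *)
have key (k : X -> R) : measurable_fun setT k -> (forall y, 0 <= k y) ->
    (\int[mu]_y (k y)%:E)%E = 1%E ->
    measurable_fun setT (T f) /\
    (Nr mu (recip q1 + a) (fun y => F y * k y `^ a)%R <= RHS%:E)%E.
  move=> mk k0 k1.
  have H j := improved_weights HUU kappa1 (Hs0 j) (Hr0 j)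
    (Hs1 j) (Hr1 j) (Hp0 j) (Hp1 j) (Hgp j) (Hgs j) (Hgr j) (Hw1 j) (Hv1 j) (Hc1 j)
    (HM j) mk k0 k1 (Hf j).
  have it10 j : 0 < it1 j by have [] := H j.
  have /choice[K HK] := fun j => (H j).2.
  have wK j : weight (K j) by have [] := HK j.
  pose w0 j x := w1 j x * K j x `^ (- ig j).
  pose v0 j x := v1 j x * K j x `^ (- ig j).
  have HW j : Wset mu UU (ig j) (s0 j) (r0 j) (w1 j) (v1 j) (w0 j, v0 j).
    by have [_ []] := HK j.
  pose A j := fine (wchar mu UU (s0 j) (r0 j) (w0 j) (v0 j)).
  have AC j : A j <= C j.
    have [_ [_ h _ _ _]] := HK j; rewrite -lee_fin fineK; first exact: h.
    rewrite ge0_fin_numE ?wchar_ge0//; exact: le_lt_trans h (ltry _).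
  pose P j := fine (lpw mu (p0 j) (v0 j) (S j (f j))).
  have Ple j : (lpw mu (p0 j) (v0 j) (S j (f j)) <= (kappa `^ (n j / it1 j) * Q j)%:E)%E.
    by have [_ [_ _ _ _ h]] := HK j; rewrite EFinM -QE; exact: h.
  have PE j : lpw mu (p0 j) (v0 j) (S j (f j)) = (P j)%:E.
    by rewrite fineK// ge0_fin_numE ?Lnorm_ge0//; exact: le_lt_trans (Ple j) (ltry _).
  have P0 j : 0 <= P j by rewrite fine_ge0// Lnorm_ge0.
  have Hf0 j : inLpw mu (p0 j) (v0 j) (S j (f j)).
    by split; [exact: HS|rewrite PE ltry].
  have mT : measurable_fun setT (T f).
    by apply: HT => j; exists (w0 j, v0 j).
  split=> //.
  (* A vanishing new norm forces S_j f_j = 0 almost everywhere. Then both sides of the estimate are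
     0, whatever the sign of [phi]. *)
  have PQ j : P j = 0 -> Q j = 0.
    move=> Pz; have := PE j; rewrite Pz /lpw => /Lnorm_eq0_eq0 h.
    have wv0 : weight (v0 j) by apply: weightM => //; exact: weight_powR.
    have [mv0 v00] := wv0; have [mv1 v10] := Hv1 j.
    have mv0' : measurable_fun setT (fun x => (S j (f j) x * v0 j x)%:E).
      by apply/measurable_EFinP/measurable_funM.
    have {h} h := h mv0' (Hp0 j).
    suff : (lpw mu (p1 j) (v1 j) (S j (f j)) <= 0)%E.
      by rewrite QE lee_fin => Qle; apply/eqP; rewrite eq_le Qle Q0.
    rewrite lpwE//.
    apply: le_trans (_ : Nr mu (recip (p1 j)) (fun y => 0 * S j (f j) y)%R <= _)%E.
      apply: le_Nr; first exact: recip_ge0.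
      - exact: measurable_funM.
      - exact: measurable_funM.
      apply: filterS h => y /(_ Logic.I)/eqP.
      rewrite eqe mulf_eq0 (gt_eqF (v00 y)) orbF => /eqP ->.
      by rewrite mul0r mulr0.
    apply: le_trans (le_NrZ _ _ _ _ _ _ _) _ => //; first exact: recip_ge0.
    by rewrite mul0e.
  have B := Hbound w0 v0 HW f Hf0.
  pose W0 x := \prod_(j < m) w0 j x.
  have wW0 : weight W0.
    by apply: weight_prod => j; apply: weightM => //; exact: weight_powR.
  pose G x := T f x * W0 x.
  have mG : measurable_fun setT G by apply: measurable_funM => //; case: wW0.
  pose Mk j := kappa `^ (it1 j)^-1.
  have HKe j : 0 < e j -> (0 < \int[mu]_y (K j y)%:E)%E /\
                        (\int[mu]_y (K j y)%:E <= (Mk j)%:E)%E.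
    move=> ej; have [_ [_ _ h _ _]] := HK j; apply: h.
    by apply: contraTneq ej => igj; rewrite /e igj maxxx ltxx.
  have Hh := Nr_holder_prod (index_enum 'I_m) x0 muT mG wK e0
    (fun j => powR_ge0 _ _) HKe.
  have kK : {ae mu, forall y, forall j, k y `^ n j <= K j y `^ n j}.
    apply: filter_forall => j; have [ig0|ig0] := ltP (ig j) 0.
      have [_ [_ _ _ h _]] := HK j; apply: filterS (h ig0) => y kKy.
      rewrite ge0_ler_powR ?nnegrE//; exact: le_trans kKy.
    apply: nearW => y; rewrite /n max_r ?powRr0//; lra.
  (* Since -ig + e = n, multiplying w0 by the K_j^(e j) leaves w1 times the K_j^(n j), and these
     dominate the k^(n j), whose product is k^a. *)
  have step1 : (Nr mu (recip q1 + a) (fun y => F y * k y `^ a)%R <=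
      Nr mu (recip q0 + \sum_(j < m) e j) (fun y => G y * \prod_(j < m) K j y `^ e j)%R)%E.
    rewrite xE; apply: le_Nr.
    - by rewrite addr_ge0// sumr_ge0.
    - apply: measurable_funM; last exact: measurable_powRX.
      by apply: measurable_funM => //; case: wW1.
    - apply: measurable_funM => //.
      by have [] := weight_prod (index_enum 'I_m) (fun j => weight_powR (e j) (wK j)).
    apply: filterS kK => y kKy.
    have -> : G y * \prod_(j < m) K j y `^ e j = F y * \prod_(j < m) K j y `^ n j.
      rewrite /G /F /W0 /W1 -!mulrA; congr (_ * _).
      rewrite -!big_split /=; apply: eq_bigr => j _; rewrite /w0 -mulrA; congr (_ * _).
      have [_ Kp] := wK j; rewrite -powRD; last by rewrite (gt_eqF (Kp y)) implybT.
      by congr (_ `^ _); rewrite igE; lra.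
    rewrite !normrM ler_wpM2l ?mulr_ge0//.
    rewrite (ger0_norm (powR_ge0 _ _)) ger0_norm; last first.
      by apply: prodr_ge0 => j _; exact: powR_ge0.
    rewrite /a powR_sum//; apply: ler_prod => j _.
    by rewrite powR_ge0 kKy.
  apply: le_trans step1 _; apply: le_trans Hh _.
  have B' : (Nr mu (recip q0) G <= (phi A * \prod_(j < m) P j)%:E)%E.
    by move: B; rewrite lpwE.
  have PP0 : 0 <= \prod_(j < m) P j by apply: prodr_ge0.
  have MM0 : 0 <= \prod_(j < m) Mk j `^ e j.
    by apply: prodr_ge0 => j _; exact: powR_ge0.
  apply: le_trans (lee_wpmul2r _ B') _; first by rewrite lee_fin.
  rewrite -EFinM lee_fin.
  have [PPz|PPn] := eqVneq (\prod_(j < m) P j) 0.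
    have QQz : \prod_(j < m) Q j = 0.
      have /prodf_eq0[j _ /eqP Pj] : \prod_(j < m) P j == 0 by rewrite PPz.
      by apply/eqP/prodf_eq0; exists j => //; rewrite (PQ j Pj).
    by rewrite /RHS QQz PPz !mulr0 mul0r.
  have PPp : 0 < \prod_(j < m) P j by rewrite lt0r PPn.
  (* The sign of phi A is read off from the assumed bound: a norm is at most phi A times a positive
     product. *)
  have phiA0 : 0 <= phi A.
    have : (0 <= (phi A * \prod_(j < m) P j)%:E)%E by apply: le_trans B'; exact: Nr_ge0.
    by rewrite lee_fin pmulr_lge0.
  have phiAC : phi A <= phi C by apply: le_monotone_coord.
  have PQprod : \prod_(j < m) P j <=
      \prod_(j < m) kappa `^ (n j / it1 j) * \prod_(j < m) Q j.
    rewrite -big_split /=; apply: ler_prod => j _; rewrite P0 /=.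
    by rewrite -lee_fin -PE.
  (* As |ig| = e + n, beta splits into the cost of the norms of the S_j f_j and the cost of
     Hoelder's inequality for T f. *)
  have betaE : kappa `^ beta = \prod_(j < m) kappa `^ (n j / it1 j) *
                               \prod_(j < m) Mk j `^ e j.
    rewrite /beta powR_sum; last by move=> j; rewrite divr_ge0// ltW.
    rewrite -big_split /=; apply: eq_bigr => j _.
    rewrite /Mk -powRrM -powRD ?(gt_eqF kap0) ?implybT//; congr (_ `^ _).
    by rewrite /ex nigE [(it1 j)^-1 * _]mulrC mulrDl addrC.
  rewrite /RHS betaE.
  apply: le_trans (_ : phi C * (\prod_(j < m) kappa `^ (n j / it1 j) *
      \prod_(j < m) Q j) * \prod_(j < m) Mk j `^ e j <= _).
    by rewrite ler_wpM2r// ler_pM.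
  by rewrite le_eqVlt; apply/orP; left; apply/eqP; ring.
have [k [mk k0 k1]] := exists_density HUU.
have [mT Hk] := key k mk k0 k1.
have mF : measurable_fun setT F by apply: measurable_funM => //; case: wW1.
have RHS0 : 0 <= RHS by rewrite -lee_fin; apply: le_trans Hk; exact: Nr_ge0.
rewrite lpwE// -/(RHS).
have : 0 <= a by rewrite sumr_ge0.
(* If a = 0, no increment is negative, k^a = 1, and the estimate for a single density is already the
   claim; otherwise duality applies. *)
rewrite le_eqVlt => /predU1P[az|ap].
  move: Hk; rewrite -az addr0 (_ : (fun y => _) = F)//.
  by apply/funext => y; rewrite powRr0 mulr1.
apply: (Nr_dual mu Hsf muT _ a) => // k' mk' k'0 k'1.
by have [] := key k' mk' k'0 k'1.
Qed.
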